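(* Let $L\ge1$ be an integer and let $\rho,\alpha,\beta>0$. Let $\gamma_1,\dots,\gamma_L$ be independent and identically distributed nonnegative random variables with cumulative distribution function $F(\gamma)=\frac{1}{1+(\gamma/(\rho\alpha))^{-\beta}}$ for $\gamma>0$. Let $f_{\gamma_{SC}}$ be the probability density function of $\gamma_{SC}=\max\{\gamma_1,\dots,\gamma_L\}$. Then the ergodic capacity $C=\frac{1}{\ln 2}\int_0^\infty\ln(1+\gamma)f_{\gamma_{SC}}(\gamma)\,d\gamma$ satisfies $$C=\frac{1}{\ln(2)\,\Gamma(L)}\,H_{3,3}^{3,2}\left[\frac{1}{\alpha\rho}\;\middle|\;\begin{matrix}(0,1/\beta),(0,1),(1,1)\\ (L,1/\beta),(0,1),(0,1)\end{matrix}\right],$$ where $H_{p,q}^{m,n}$ is the (univariate) Fox H-function.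
   Context: The univariate Fox H-function is $$H_{p,q}^{m,n}\left[z\;\middle|\;\begin{matrix}(a_1,A_1),\dots,(a_p,A_p)\\(b_1,B_1),\dots,(b_q,B_q)\end{matrix}\right]=\frac{1}{2\pi i}\int_{c}\frac{\prod_{j=1}^m\Gamma(b_j-B_jt)\prod_{j=1}^n\Gamma(1-a_j+A_jt)}{\prod_{j=n+1}^p\Gamma(a_j-A_jt)\prod_{j=m+1}^q\Gamma(1-b_j+B_jt)}\,z^{t}\,dt,$$ where the contour $c$ runs from $-i\infty$ to $+i\infty$ and separates the poles of the $\Gamma(b_j-B_jt)$, $1\le j\le m$, (on its right) from the poles of the $\Gamma(1-a_j+A_jt)$, $1\le j\le n$ (on its left). For the parameters in the claim one may take a vertical line $\mathrm{Re}\,t=\tau$ with $-\min(1,\beta)<\tau<0$. In the application, $\gamma_l$ is the SNR of the $l$-th branch of a selection combining receiver and $\rho$ is the average transmit SNR. *)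

(* Defs.v *)
(* Complex numbers are R[i], over an arbitrary realType R. *)
From HB Require Import structures.
From mathcomp Require Export all_boot all_order all_algebra.
From mathcomp Require Export complex.
From mathcomp Require Export all_classical all_reals all_analysis.

Set Implicit Arguments.
Unset Strict Implicit.
Unset Printing Implicit Defensive.

Import Order.TTheory GRing.Theory Num.Theory.
Import numFieldNormedType.Exports.

Local Open Scope classical_set_scope.
Local Open Scope ring_scope.
Local Open Scope complex_scope.

Section ComplexFunctions.
Context {R : realType}.
Implicit Types (z t : R[i]) (f : R -> R[i]) (D : set R).

Definition cexp z : R[i] :=
  (expR (complex.Re z) * cos (complex.Im z))
    +i* (expR (complex.Re z) * sin (complex.Im z)).

(* x ^ z for a positive real base x, with the real logarithm of x. *)
Definition rcpow (x : R) z : R[i] := cexp (z * (ln x)%:C).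

Definition cintegrable D f : Prop :=
  lebesgue_measure.-integrable D (fun x => (complex.Re (f x))%:E) /\
  lebesgue_measure.-integrable D (fun x => (complex.Im (f x))%:E).

Definition cintegral D f : R[i] :=
  (\int[lebesgue_measure]_(x in D) complex.Re (f x))
    +i* (\int[lebesgue_measure]_(x in D) complex.Im (f x)).

Definition euler_integral z : R[i] :=
  cintegral `]0, +oo[ (fun x : R => rcpow x (z - 1) * (expR (- x))%:C).

(* The Gamma function: Euler's integral for Re z > 0, continued to Re z <= 0
   by Gamma z = Gamma (z + N) / (z (z + 1) ... (z + N - 1)), where N is the
   least natural number such that Re (z + N) > 0.  At the poles 0, -1, -2, ...
   the denominator vanishes, so that cGamma z = 0 there and (cGamma z)^-1
   agrees everywhere with the entire function 1 / Gamma. *)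
Definition gamma_shift z : nat :=
  if 0 < complex.Re z then 0%N else (Num.truncn (- complex.Re z)).+1.

Definition cGamma z : R[i] :=
  euler_integral (z + (gamma_shift z)%:R)
    / \prod_(k < gamma_shift z) (z + k%:R).

(* Points of the vertical line Re t = tau, traversed upwards: t = tau + i y,
   dt = i dy. *)
Definition vline_integrable (tau : R) (g : R[i] -> R[i]) : Prop :=
  cintegrable setT (fun y => g (tau +i* y)).

Definition vline_integral (tau : R) (g : R[i] -> R[i]) : R[i] :=
  'i * cintegral setT (fun y => g (tau +i* y)).

End ComplexFunctions.

Section FoxH.
Context {R : realType}.
(* The parameters (a_1, A_1), ..., (a_p, A_p) and (b_1, B_1), ..., (b_q, B_q);
   p and q are the sizes of the sequences a and b. *)
Variables (m n : nat) (a b : seq (R[i] * R)).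

Definition foxH_integrand (z : R) (t : R[i]) : R[i] :=
  (\prod_(u <- take m b) cGamma (u.1 - u.2%:C * t)
     * \prod_(u <- take n a) cGamma (1 - u.1 + u.2%:C * t))
  / (\prod_(u <- drop n a) cGamma (u.1 - u.2%:C * t)
     * \prod_(u <- drop m b) cGamma (1 - u.1 + u.2%:C * t))
  * rcpow z t.

(* The line Re t = tau has the poles of Gamma (b_j - B_j t), j <= m, on its
   right and those of Gamma (1 - a_j + A_j t), j <= n, on its left; the poles
   of Gamma are the integers - k, k >= 0. *)
Definition foxH_separating (tau : R) : Prop :=
  (forall u, u \in take m b -> forall (k : nat) (t : R[i]),
     u.1 - u.2%:C * t = - k%:R -> tau < complex.Re t) /\
  (forall u, u \in take n a -> forall (k : nat) (t : R[i]),
     1 - u.1 + u.2%:C * t = - k%:R -> complex.Re t < tau).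

(* "The Fox H-function at z > 0 is well defined and has value h": a separating
   vertical contour exists, and along each such contour the Mellin-Barnes
   integral converges absolutely and yields h. *)
Definition is_foxH (z : R) (h : R[i]) : Prop :=
  (exists tau, foxH_separating tau) /\
  (forall tau, foxH_separating tau ->
     vline_integrable tau (foxH_integrand z) /\
     (2 * pi%:C * 'i)^-1 * vline_integral tau (foxH_integrand z) = h).

End FoxH.

Section Probability.
Context {d : measure_display} {T : measurableType d} {R : realType}.
Variable P : probability T R.

Definition mutually_independent (I : finType) (X : I -> {RV P >-> R}) : Prop :=
  forall (J : {set I}) (B : I -> set R),
    (forall i, i \in J -> measurable (B i)) ->
    P (\big[setI/setT]_(i in J) (X i @^-1` B i))
      = (\prod_(i in J) P (X i @^-1` B i))%E.

Definition is_pdf (Y : T -> R) (f : R -> R) : Prop :=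
  [/\ measurable_fun setT f, forall x, 0 <= f x &
      forall B : set R, measurable B ->
        P (Y @^-1` B) = (\int[lebesgue_measure]_(x in B) (f x)%:E)%E].

End Probability.

(* The maximum of the branches.  The default value 0 of the iterated maximum is
   harmless when L > 0 and the branches are nonnegative. *)
Definition selection_combining (T : Type) (R : realType) (L : nat)
    (X : 'I_L -> T -> R) (w : T) : R :=
  \big[Num.max/0]_(i < L) X i w.

Definition capacity_integrand {R : realType} (f : R -> R) (x : R) : R :=
  ln (1 + x) * f x.

Definition ergodic_capacity {R : realType} (f : R -> R) : R :=
  (ln 2)^-1 * \int[lebesgue_measure]_(x in `[0, +oo[) capacity_integrand f x.

(* Main.v *)
From HB Require Import structures.
Require Import Defs.
From mathcomp Require Import all_boot all_order all_algebra complex.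
From mathcomp Require Import all_classical all_reals all_analysis.
From mathcomp Require Import measurable_realfun ring lra.

(* After the substitution [x = expR u], every integral runs over the whole real
   line.  With [softplus u = ln (1 + expR u)] and [-1 < Re t < 0], the beta
   integral and an integration by parts give
     Gamma (-t) Gamma (1 + t) / (-t) = K t := \int softplus u * expR (t u) du,
   and Gamma (L - t / beta) Gamma (1 + t / beta) / Gamma L is the moment
   E[(gamma_SC / (rho alpha)) ^ (-t)].  Hence the integrand of the H-function is
   Gamma L * K t * E[gamma_SC ^ (-t)].  As K decays quadratically on vertical
   lines, Fubini and the Fourier inversion of K turn its integral into
   2 pi i * Gamma L * E[ln (1 + gamma_SC)].  The quotient
   Gamma (-t) / Gamma (1 - t) requires that Gamma has no zero. *)

Set Implicit Arguments.
Unset Strict Implicit.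
Unset Printing Implicit Defensive.

Import Order.TTheory GRing.Theory Num.Theory.
Import numFieldNormedType.Exports.
Import HBNNSimple.

Local Open Scope classical_set_scope.
Local Open Scope ring_scope.
Local Open Scope complex_scope.

Local Notation mu := (@lebesgue_measure _).
Local Notation L1 f := (lebesgue_measure.-integrable setT (EFin \o f)).
Local Notation Re := complex.Re.
Local Notation Im := complex.Im.
Local Notation normc := Normc.normc.
Local Notation cint f := (cintegral setT f).
Local Notation cL1 f := (cintegrable setT f).

(** * Integrals over the real line *)

Section RealIntegrals.
Context {R : realType}.
Implicit Types f g F : R -> R.

(** No contour is ever shifted and no complex analysis enters: complex integrals are pairs of real
    ones. On each separating line the abscissa [tau] puts a weight [expR (tau v)] on one factor and
    [expR (- tau v)] on the other; the weights cancel after inversion, which is why all lines give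
    the same value. The logarithmic variables serve one purpose throughout: on the admissible strip
    the Gamma, beta and logarithmic kernels are bounded by multiples of [expR (- s |u|)], which
    settles integrability and boundary terms. The density of the maximum is an arbitrary measurable
    one, so no pointwise substitution into it is possible; it is compared with its model in
    logarithmic variables as a measure, on the rays []-oo, x]]. The absence of zeros of Gamma rests
    on its functional equation and positivity far to the right, the decay of [K] on crude bounds of
    Gamma on vertical lines; neither needs a reflection formula or Stirling asymptotics. *)

Lemma integrable_dominated f g : measurable_fun setT f -> L1 g ->
  (forall x, `|f x| <= g x) -> L1 f.
Proof.
move=> mf gi fg; apply: (le_integrable measurableT _ _ gi).
  exact/measurable_EFinP.
by move=> x _; rewrite /= lee_fin (le_trans (fg x))// ler_norm.
Qed.

Lemma Rintegral_cvg_itv (D : set R) f : measurable D ->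
    mu.-integrable D (EFin \o f) ->
  \int[mu]_(x in D `&` `[- n%:R, n%:R]) f x @[n --> \oo]
    --> \int[mu]_(x in D) f x.
Proof.
move=> mD fi.
have mf : measurable_fun D f by apply/measurable_EFinP;
  exact: measurable_int fi.
pose f_ n : R -> \bar R := (EFin \o f) \_ `[- n%:R, n%:R].
rewrite /Rintegral; apply: fine_cvg.
rewrite fineK; last exact: integrable_fin_num.
suff : (\int[mu]_(x in D) f_ n x)%E @[n --> \oo] -->
  (\int[mu]_(x in D) (f x)%:E)%E.
  apply: cvg_trans; apply: near_eq_cvg; near=> n.
  by rewrite integral_mkcondr.
have [] // := @dominated_convergence _ _ _ mu D mD f_ (EFin \o f)
  (abse \o (EFin \o f)).
- move=> n; apply/measurable_restrict => //.
  by apply/measurable_EFinP; apply: measurable_funS mf => //; exact: subIsetl.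
- exact/measurable_EFinP.
- apply: aeW => x Dx; apply: cvg_near_cst.
  near=> n; rewrite /f_ /= patchE mem_set//= in_itv/= -ler_norml.
  by near: n; exact: nbhs_infty_ger.
- exact: integrable_abse.
- apply: aeW => x n Dx; rewrite /f_ /= patchE; case: ifP => // _.
  by rewrite [X in `|X|%E](_ : _ = 0%E)// abse0.
Unshelve. all: by end_near. Qed.

(** Integrability of [f] replaces a sign condition: the integral is the limit of those over
    [[0, n]], where the ordinary theorem applies. The oscillating Laplace integral of the cosine
    needs this signed version. *)
Lemma Rintegral_FTC0y F f (l : R) : continuous f ->
    mu.-integrable `[0, +oo[ (EFin \o f) ->
    (forall x, is_derive x (1 : R) F (f x)) -> F x @[x --> +oo] --> l ->
  \int[mu]_(x in `[0, +oo[) f x = l - F 0.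
Proof.
move=> cf fi dF Fl.
have := Rintegral_cvg_itv (measurable_itv _) fi.
have FnE : \forall n \near \oo,
    \int[mu]_(x in `[0, +oo[ `&` `[- n%:R, n%:R]) f x = F n%:R - F 0.
  near=> n.
  have n0 : (0 : R) < n%:R by near: n; exact: nbhs_infty_gtr.
  have -> : `[0, +oo[ `&` `[- n%:R, n%:R] = `[(0 : R), n%:R]%classic.
    rewrite eqEsubset; split => x /=; rewrite !in_itv/= ?andbT.
      by move=> [-> /andP[_ ->]].
    by move=> /andP[x0 ->]; rewrite x0 (le_trans _ x0)// oppr_le0 ltW.
  rewrite /Rintegral (@continuous_FTC2 _ f F)//.
  - exact: continuous_subspaceT.
  - have cF : continuous F.
      by move=> x; apply/differentiable_continuous/derivable1_diffP/ex_derive.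
    split => [x _||]; first exact: ex_derive.
      by apply: cvg_at_right_filter; exact: cF.
    by apply: cvg_at_left_filter; exact: cF.
  - by move=> x _; rewrite derive1E derive_val.
move/(cvg_lim (@Rhausdorff R)) => <-.
apply: (cvg_lim (@Rhausdorff R)).
have : F n%:R - F 0 @[n --> \oo] --> l - F 0.
  apply: cvgB; last exact: cvg_cst.
  by move/cvg_pinftyP : Fl; apply; exact: cvgr_idn.
apply: cvg_trans; apply: near_eq_cvg.
by apply: filterS FnE => n ->.
Unshelve. all: by end_near. Qed.

Lemma integrable_expR_abs (d : R) : 0 < d -> L1 (fun x => expR (- d * `|x|)).
Proof.
move=> d0; apply/integrableP; split.
  by apply/measurable_EFinP; apply: measurableT_comp => //;
    apply: measurable_funM => //; exact: measurableT_comp.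
under eq_integral do rewrite /= ger0_norm ?expR_ge0//.
rewrite ge0_symfun_integralT//; last 2 first.
- move=> x; apply: continuous_comp; last exact: continuous_expR.
  by apply: continuousM; [exact: cst_continuous|exact: norm_continuous].
- by move=> x /=; rewrite normrN.
rewrite (_ : [set x | 0 <= x] = `[0, +oo[%classic); last first.
  by apply/seteqP; split => x /=; rewrite in_itv/= andbT.
rewrite (@ge0_continuous_FTC2y _ (fun x => expR (- d * `|x|))
  (fun x => - d^-1 * expR (- d * x)) 0 0).
- by rewrite mulr0 expR0 mulr1 sub0e EFinN oppeK -EFinM ltry.
- by move=> x _; exact: expR_ge0.
- apply: continuous_subspaceT => x; apply: continuous_comp;
    last exact: continuous_expR.
  by apply: continuousM; [exact: cst_continuous|exact: norm_continuous].
- rewrite -(mulr0 (- d^-1)); apply: cvgM; first exact: cvg_cst.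
  rewrite (_ : (fun x => expR (- d * x)) = (fun z => expR (- z)) \o
    (fun z => d * z)).
    apply: (@cvg_comp _ _ _ _ _ _ (pinfty_nbhs R)); last exact: cvgr_expR.
    exact: gt0_cvgMry.
  by apply: eq_fun => x; rewrite mulNr.
- by move=> x _; apply: ex_derive.
- apply: cvg_at_right_filter; apply: cvgM; first exact: cvg_cst.
  by apply: continuous_comp;
    [apply: continuousM => //; exact: cst_continuous|exact: continuous_expR].
- move=> x; rewrite in_itv/= andbT => x0; rewrite derive1E derive_val.
  rewrite (gtr0_norm x0) /GRing.scale/= !mulr1 ?addr0 ?mulr0 ?add0r.
  by rewrite mulrCA mulrNN mulVf ?mulr1// gt_eqF.
Qed.

Lemma ge0_integral_affine f (a b : R) : 0 < a -> continuous f ->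
    (forall x, 0 <= f x) ->
  (\int[mu]_x (f x)%:E = \int[mu]_x (f (a * x + b) * a)%:E)%E.
Proof.
move=> a0 cf f0.
have dF x : is_derive x (1 : R) (fun x => a * x + b) a.
  by apply: is_derive_eq; rewrite /GRing.scale/= mulr1 addr0.
have F'E : (fun x => a * x + b)^`()%classic = cst a.
  by apply/funext => x; rewrite derive1E derive_val.
rewrite (increasing_ge0_integration_by_substitutionT
  (F := fun x => a * x + b))// ?F'E//.
- by move=> x y xy; rewrite ltrD2r ltr_pM2l.
- by move=> x; exact: cst_continuous.
- exact: is_cvg_cst.
- exact: is_cvg_cst.
- apply/cvgrNyPle => M; near=> x.
  rewrite -lerBrDr mulrC -ler_pdivlMr//; near: x.
- apply/cvgryPge => M; near=> x.
  rewrite -lerBlDr mulrC -ler_pdivrMr//; near: x.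
Unshelve. all: by end_near. Qed.

Lemma integrable_affine f (a b : R) : 0 < a -> continuous f -> L1 f ->
  L1 (fun x => f (a * x + b)).
Proof.
move=> a0 cf fi; apply/integrableP; split.
  apply/measurable_EFinP; apply: measurableT_comp.
    exact: continuous_measurable_fun.
  by apply: measurable_funD => //; exact: measurable_funM.
have cnf : continuous (fun x => `|f x|).
  by move=> x; apply: continuous_comp; [exact: cf|exact: norm_continuous].
have [_] := integrableP _ _ _ fi.
rewrite /= (ge0_integral_affine b a0 cnf)// => H.
have -> : (\int[mu]_x `|(f (a * x + b))%:E| =
    a^-1%:E * \int[mu]_x (`|f (a * x + b)| * a)%:E)%E.
  rewrite -ge0_integralZl//.
  - by apply: eq_integral => x _; rewrite -EFinM mulrCA mulVf ?gt_eqF// mulr1.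
  - apply/measurable_EFinP; apply: measurable_funM => //.
    apply: measurableT_comp => //; apply: measurableT_comp => //.
      exact: continuous_measurable_fun.
    by apply: measurable_funD => //; exact: measurable_funM.
  - by move=> x _; rewrite lee_fin mulr_ge0// ltW.
  - by rewrite lee_fin invr_ge0 ltW.
by rewrite lte_mul_pinfty// lee_fin invr_ge0 ltW.
Qed.

(** The nonnegative case applies to [|f|] and to [|f| + f], and subtraction gives the signed case.
    The same decomposition recurs in [Rintegral_law] and [Rintegral_Nyc]. *)
Lemma Rintegral_affine f (a b : R) : 0 < a -> continuous f -> L1 f ->
  \int[mu]_x f (a * x + b) = a^-1 * \int[mu]_x f x.
Proof.
move=> a0 cf fi.
have ai := integrable_affine b a0 cf fi.
have cnf : continuous (fun x => `|f x|).
  by move=> x; apply: continuous_comp; [exact: cf|exact: norm_continuous].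
have cpf : continuous (fun x => `|f x| + f x).
  by move=> x; apply: cvgD; [exact: cnf|exact: cf].
have ge0E g : continuous g -> (forall x, 0 <= g x) -> L1 g ->
    \int[mu]_x g x = a * \int[mu]_x g (a * x + b).
  move=> cg g0 gi; rewrite /Rintegral (ge0_integral_affine b a0 cg g0).
  rewrite -[LHS]/(\int[mu]_x (g (a * x + b) * a)) RintegralZr 1?mulrC//.
  exact: (integrable_affine _ a0 cg gi).
have ni := integrable_norm fi.
have nai := integrable_norm ai.
have := ge0E _ cnf (fun=> normr_ge0 _) ni.
have : \int[mu]_x (`|f x| + f x) =
    a * \int[mu]_x (`|f (a * x + b)| + f (a * x + b)).
  apply: ge0E => //.
    by move=> x; rewrite -lerBlDr sub0r ler_normr lexx orbT.
  exact: (integrableD _ ni fi).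
rewrite !RintegralD// mulrDr => H1 H2; move: H1; rewrite H2.
by move/addrI => ->; rewrite mulrA mulVf ?mul1r// gt_eqF.
Qed.

(** * Densities as measures and change of law *)

Lemma density_measure (q : R -> R) : measurable_fun setT q ->
    (forall x, 0 <= q x) ->
  exists m : {measure set (measurableTypeR R) -> \bar R},
    forall V, m V = (\int[mu]_(x in V) (q x)%:E)%E.
Proof.
move=> mq q0.
pose m (V : set (measurableTypeR R)) := (\int[mu]_(x in V) (q x)%:E)%E.
have m0 : m set0 = 0%E by rewrite /m integral_set0.
have mge0 V : (0 <= m V)%E by apply: integral_ge0 => x _; rewrite lee_fin.
have madd : semi_sigma_additive m.
  move=> /= F mF tF mUF; rewrite /m; apply: cvg_toP.
    apply: ereal_nondecreasing_is_cvgn => i j ij.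
    by apply: lee_sum_nneg_natr => // k _ _; exact: mge0.
  rewrite ge0_integral_bigcup//=.
  - by apply/measurable_funTS/measurable_EFinP.
  - by move=> x _; rewrite lee_fin.
pose M : {measure set (measurableTypeR R) -> \bar R} :=
  HB.pack m (isMeasure.Build _ _ _ m m0 mge0 madd).
by exists M.
Qed.

(** Both sides are limits of integrals of the same nondecreasing sequence of simple functions, for
    which the equality is linearity over the level sets. *)
Lemma ge0_integral_density (q : R -> R)
    (m : {measure set (measurableTypeR R) -> \bar R}) (g : R -> \bar R) :
    measurable_fun setT q -> (forall x, 0 <= q x) ->
    (forall V, measurable V -> m V = (\int[mu]_(x in V) (q x)%:E)%E) ->
    measurable_fun setT g -> (forall x, 0 <= g x)%E ->
  (\int[m]_x g x = \int[mu]_x (g x * (q x)%:E))%E.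
Proof.
move=> mq q0 mE mg g0.
have emq : measurable_fun setT (EFin \o q) by exact/measurable_EFinP.
have eq0 x : (0 <= (q x)%:E)%E by rewrite lee_fin.
pose h := @nnsfun_approx _ (measurableTypeR R) R setT measurableT g mg.
have hg x : (h n x)%:E @[n --> \oo] --> g x.
  exact: (@cvg_nnsfun_approx _ (measurableTypeR R) R setT measurableT g mg).
have ndh x : {homo (fun n => (h n x)%:E) : n m / (n <= m)%N >-> (n <= m)%E}.
  by move=> i j ij; rewrite lee_fin; exact/lefP/nd_nnsfun_approx.
have -> : (\int[m]_x g x = limn (fun n => \int[m]_x (h n x)%:E))%E.
  rewrite -monotone_convergence//.
  - by apply: eq_integral => x _; apply/esym/cvg_lim.
  - by move=> n; apply/measurable_EFinP/measurable_funP.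
  - by move=> n x _; rewrite lee_fin.
have -> : (\int[mu]_x (g x * (q x)%:E) =
    limn (fun n => \int[mu]_x ((h n x)%:E * (q x)%:E)))%E.
  rewrite -monotone_convergence//.
  - apply: eq_integral => x _; apply/esym/cvg_lim => //.
    by apply: cvgeZr => //; exact: hg.
  - by move=> n; apply: emeasurable_funM => //;
      apply/measurable_EFinP/measurable_funP.
  - by move=> n x _; rewrite mule_ge0// lee_fin.
  - by move=> x _ i j ij; rewrite lee_wpmul2r//; exact: ndh.
congr (limn _); apply/funext => n.
have mi r : measurable (h n @^-1` [set r]) by exact: measurable_funPTI.
transitivity (\sum_(y \in range (h n)) (y%:E * m (h n @^-1` [set y])))%E.
  by rewrite integral_nnsfun// patch_setT sintegralE.
transitivity (\int[mu]_x \sum_(y \in range (h n))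
   (y%:E * ((\1_(h n @^-1` [set y]) x)%:E * (q x)%:E)))%E; last first.
  apply: eq_integral => x _.
  under eq_fsbigr do rewrite muleA.
  rewrite -ge0_mule_fsuml; last by move=> y; exact: nnfun_muleindic_ge0.
  congr (_ * _)%E; rewrite [in RHS]fimfunE -fsumEFin//.
rewrite ge0_integral_fsum//; last 2 first.
- move=> y; apply: measurable_funeM; apply: emeasurable_funM => //.
  exact/measurable_EFinP.
- by move=> y x _; rewrite muleA mule_ge0// nnfun_muleindic_ge0.
apply: eq_fsbigr => r /[!inE] -[t _ rE].
have r0 : 0 <= r by rewrite -rE.
rewrite ge0_integralZl//.
- congr (_ * _)%E; rewrite mE// [LHS]integral_mkcond.
  by apply: eq_integral => x _; rewrite epatch_indic muleC.
- by apply: emeasurable_funM => //; exact/measurable_EFinP.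
- by move=> x _; rewrite mule_ge0// lee_fin.
Qed.

(** Rays are stable under intersection and generate the Borel sets, []a, b]] being a difference of
    two of them. The rays []-oo, n]] exhaust the line with finite measure, which provides the
    sigma-finiteness that uniqueness asks for. *)
Lemma measure_unique_rays (m1 m2 : {measure set (measurableTypeR R) -> \bar R})
  :
    (forall x : R, m1 `]-oo, x]%classic = m2 `]-oo, x]%classic) ->
    (forall x : R, m1 `]-oo, x]%classic < +oo)%E ->
  forall B, measurable B -> m1 B = m2 B.
Proof.
move=> m12 fin B mB.
apply: (@measure_unique _ R (measurableTypeR R)
  [set A | exists x : R, A = `]-oo, x]%classic]
   (fun n => `]-oo, n%:R]%classic) _ _ _ _ m1 m2) => //.
- rewrite eqEsubset; split => A.
    apply: smallest_sub; first exact: smallest_sigma_algebra.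
    move=> I [[a b] _ <-]/=.
    rewrite (_ : `]a, b]%classic = `]-oo, b] `&` ~` `]-oo, a]).
      suff : [set A0 | exists x : R, A0 = `]-oo, x]%classic].-sigma.-measurable
        (`]-oo, b] `&` ~` `]-oo, a]) by [].
      apply: measurableI; last apply: measurableC.
        by apply: sub_sigma_algebra; exists b.
      by apply: sub_sigma_algebra; exists a.
    apply/seteqP; split => x /=; rewrite !in_itv/=.
      by move=> /andP[ax xb]; split => //; apply/negP; rewrite -ltNge.
    by move=> [xb /negP]; rewrite -ltNge => ax; rewrite ax xb.
  by apply: smallest_sub; [exact: smallest_sigma_algebra|move=> A' /= [x ->]].
- move=> _ _ [x ->] [y ->]; exists (Num.min x y).
  by apply/seteqP; split => z /=; rewrite !in_itv/= le_min => /andP.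
- by move=> n; exists n%:R.
- rewrite -subTset => x _; exists (Num.truncn x).+1 => //=.
  by rewrite in_itv/= ltW// truncnS_gt.
- by move=> _ [x ->].
Qed.

Section law.
Variables (f q phi : R -> R).
Hypotheses (mf : measurable_fun setT f) (f0 : forall x, 0 <= f x).
Hypotheses (mq : measurable_fun setT q) (q0 : forall x, 0 <= q x).
Hypotheses (mphi : measurable_fun setT phi).
Hypothesis fin : forall x, (\int[mu]_(y in `]-oo, x]) (f y)%:E < +oo)%E.
Hypothesis fq : forall x, (\int[mu]_(y in `]-oo, x]) (f y)%:E =
  \int[mu]_(w in [set w | (phi w <= x)%R]) (q w)%:E)%E.

(** By [fq], the measure [f dx] and the image of [q dw] under [phi] agree on rays, hence everywhere.
    This substitution rule works for a merely measurable [f], such as a density known only through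
    [is_pdf]. *)
Lemma ge0_integral_law (g : R -> \bar R) : measurable_fun setT g ->
    (forall x, 0 <= g x)%E ->
  (\int[mu]_x (g x * (f x)%:E) = \int[mu]_w (g (phi w) * (q w)%:E))%E.
Proof.
move=> mg g0.
have [mfm mfE] := density_measure mf f0.
have [mqm mqE] := density_measure mq q0.
rewrite -(ge0_integral_density mf f0 (fun V _ => mfE V) mg g0).
have mgp : measurable_fun setT (g \o phi) by exact: measurableT_comp.
rewrite -(ge0_integral_density mq q0 (fun V _ => mqE V) mgp (fun x => g0 _)).
pose push := [the {measure set (measurableTypeR R) -> \bar R} of
  pushforward mqm (phi : measurableTypeR R -> measurableTypeR R)].
transitivity (\int[push mphi]_x g x)%E.
  apply: eq_measure_integral => A mA _.
  apply: (@measure_unique_rays mfm (push mphi)) => // x; last by rewrite mfE.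
  rewrite mfE /push/= /pushforward mqE fq.
  have -> // : [set w | (phi w <= x)%R] = phi @^-1` `]-oo, x]%classic.
  by apply/seteqP; split => y; rewrite /= in_itv.
by rewrite ge0_integral_pushforward.
Qed.

Lemma integrable_law (h : R -> R) : measurable_fun setT h ->
  L1 (fun x => h x * f x) <-> L1 (fun w => h (phi w) * q w).
Proof.
move=> mh.
have E : (\int[mu]_x `|(h x * f x)%:E| = \int[mu]_w `|(h (phi w) * q w)%:E|)%E.
  have := @ge0_integral_law (fun x => `|h x|%:E).
  under eq_integral do rewrite /= -EFinM -[X in _ * X]ger0_norm// -normrM.
  under [in RHS]eq_integral do rewrite /= -EFinM -[X in _ * X]ger0_norm//
    -normrM.
  apply => //.
  by apply/measurable_EFinP; exact: measurableT_comp.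
split=> /integrableP[_ lt]; apply/integrableP; split.
- apply/measurable_EFinP; apply: measurable_funM => //; exact: measurableT_comp.
- by rewrite /= -E.
- by apply/measurable_EFinP; apply: measurable_funM.
- by rewrite /= E.
Qed.

Lemma Rintegral_law (h : R -> R) : measurable_fun setT h ->
  L1 (fun x => h x * f x) ->
  \int[mu]_x (h x * f x) = \int[mu]_w (h (phi w) * q w).
Proof.
move=> mh hi; have hi' := (integrable_law mh).1 hi.
have E g : measurable_fun setT g -> (forall x, 0 <= g x) ->
    \int[mu]_x (g x * f x) = \int[mu]_w (g (phi w) * q w).
  move=> mg g0; rewrite /Rintegral; congr fine.
  under eq_integral do rewrite EFinM.
  under [in RHS]eq_integral do rewrite EFinM.
  apply: (@ge0_integral_law (EFin \o g)) => //; exact/measurable_EFinP.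
have mnh : measurable_fun setT (fun x => `|h x|) by exact: measurableT_comp.
have ni : L1 (fun x => `|h x| * f x).
  have := integrable_norm hi; congr (integrable _ _ _).
  by apply/funext => x /=; rewrite normrM (ger0_norm (f0 _)).
have ni' := (integrable_law mnh).1 ni.
have := E _ mnh (fun=> normr_ge0 _).
have : \int[mu]_x ((`|h x| + h x) * f x) =
    \int[mu]_x ((`|h (phi x)| + h (phi x)) * q x).
  apply: E; first exact: measurable_funD.
  by move=> x; rewrite -lerBlDr sub0r ler_normr lexx orbT.
under eq_Rintegral do rewrite mulrDl.
under [in RHS]eq_Rintegral do rewrite mulrDl.
by rewrite !RintegralD// => H1 H2; move: H1; rewrite H2 => /addrI.
Qed.

End law.

End RealIntegrals.

(** * Complex-valued integrals *)

Section ComplexIntegrals.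
Context {R : realType}.

Lemma complex_ext (z w : R[i]) : Re z = Re w -> Im z = Im w -> z = w.
Proof. by case: z w => a b [c d] /= -> ->. Qed.

Lemma cReM (z w : R[i]) : Re (z * w) = Re z * Re w - Im z * Im w.
Proof. by case: z w => a b [c d]. Qed.

Lemma cImM (z w : R[i]) : Im (z * w) = Re z * Im w + Im z * Re w.
Proof. by case: z w => a b [c d]. Qed.

Lemma cReD (z w : R[i]) : Re (z + w) = Re z + Re w.
Proof. by case: z w => a b [c d]. Qed.

Lemma cImD (z w : R[i]) : Im (z + w) = Im z + Im w.
Proof. by case: z w => a b [c d]. Qed.

Lemma cReN (z : R[i]) : Re (- z) = - Re z.
Proof. by case: z. Qed.

Lemma ler_Re_normc (z : R[i]) : `|Re z| <= normc z.
Proof.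
by case: z => a b /=; rewrite -sqrtr_sqr ler_wsqrtr// lerDl sqr_ge0.
Qed.

Lemma ler_Im_normc (z : R[i]) : `|Im z| <= normc z.
Proof.
by case: z => a b /=; rewrite -sqrtr_sqr ler_wsqrtr// lerDr sqr_ge0.
Qed.

Lemma normc_leD (z : R[i]) : normc z <= `|Re z| + `|Im z|.
Proof.
case: z => a b /=; rewrite -[leRHS]ger0_norm ?addr_ge0// -sqrtr_sqr
  ler_wsqrtr//.
rewrite sqrrD !real_normK ?num_real// lerD2r lerDl.
by rewrite mulrn_wge0// mulr_ge0.
Qed.

Lemma normc_ge0 (z : R[i]) : 0 <= normc z.
Proof. by case: z => a b /=; exact: sqrtr_ge0. Qed.

Lemma cexpD (z w : R[i]) : cexp (z + w) = cexp z * cexp w.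
Proof.
case: z w => a b [c d]; apply: complex_ext => /=; rewrite expRD ?cosD ?sinD;
  ring.
Qed.

Lemma normc_cexp (z : R[i]) : normc (cexp z) = expR (Re z).
Proof.
rewrite /cexp /= !exprMn -mulrDr cos2Dsin2 mulr1 sqrtr_sqr ger0_norm//.
Qed.

Lemma cexp_real (x : R) : cexp x%:C = (expR x)%:C.
Proof. by rewrite /cexp /= cos0 sin0 mulr1 mulr0. Qed.

Lemma normc_real (x : R) : normc x%:C = `|x|.
Proof. by rewrite /= expr0n/= addr0 sqrtr_sqr. Qed.

Section measurability.
Context d (T : measurableType d).
Implicit Types f g : T -> R[i].

Definition cmeasurable f :=
  measurable_fun setT (fun x => Re (f x)) /\
  measurable_fun setT (fun x => Im (f x)).

Lemma cmeasurable_cst (c : R[i]) : cmeasurable (fun=> c).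
Proof. by split; exact: measurable_cst. Qed.

Lemma cmeasurable_real (a : T -> R) : measurable_fun setT a ->
  cmeasurable (fun x => (a x)%:C).
Proof. by move=> ma; split => //; exact: measurable_cst. Qed.

Lemma cmeasurableM f g : cmeasurable f -> cmeasurable g ->
  cmeasurable (fun x => f x * g x).
Proof.
move=> [f1 f2] [g1 g2]; split.
- rewrite (_ : (fun _ => _) =
    (fun x => Re (f x) * Re (g x) - Im (f x) * Im (g x))).
    by apply: measurable_funB; exact: measurable_funM.
  by apply/funext => x; rewrite cReM.
- rewrite (_ : (fun _ => _) =
    (fun x => Re (f x) * Im (g x) + Im (f x) * Re (g x))).
    by apply: measurable_funD; exact: measurable_funM.
  by apply/funext => x; rewrite cImM.
Qed.

Lemma cmeasurable_exp f : cmeasurable f -> cmeasurable (fun x => cexp (f x)).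
Proof.
have ms : measurable_fun setT (@sin R).
  by apply: continuous_measurable_fun; exact: continuous_sin.
have mc : measurable_fun setT (@cos R).
  by apply: continuous_measurable_fun; exact: continuous_cos.
by move=> [f1 f2]; split; apply: measurable_funM; exact: measurableT_comp.
Qed.

End measurability.

Lemma cmeasurable_comp d d' (T : measurableType d) (U : measurableType d')
  (f : U -> R[i]) (h : T -> U) : cmeasurable f -> measurable_fun setT h ->
  cmeasurable (f \o h).
Proof.
move=> [f1 f2] mh; split.
  exact: (measurableT_comp (f := fun x => Re (f x))).
exact: (measurableT_comp (f := fun x => Im (f x))).
Qed.

Implicit Types f g : R -> R[i].

Lemma eq_cintegral f g : f =1 g -> cint f = cint g.
Proof. by move=> /funext ->. Qed.

Lemma eq_cintegrable f g : f =1 g -> cL1 f -> cL1 g.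
Proof. by move=> /funext ->. Qed.

Lemma cmeasurable_int f : cL1 f -> cmeasurable f.
Proof.
by move=> [/measurable_int/measurable_EFinP f1 /measurable_int/measurable_EFinP
  f2].
Qed.

Lemma cintegrable_dominated f (G : R -> R) : cmeasurable f -> L1 G ->
  (forall x, normc (f x) <= G x) -> cL1 f.
Proof.
move=> [f1 f2] gi fG; split.
- apply: integrable_dominated gi _ => // x.
  exact: le_trans (ler_Re_normc _) (fG x).
- apply: integrable_dominated gi _ => // x.
  exact: le_trans (ler_Im_normc _) (fG x).
Qed.

(** Bounding the real and the imaginary part separately costs the factor 2, which is harmless in a
    domination argument. *)
Lemma normc_cintegral_le f (G : R -> R) : cmeasurable f -> L1 G ->
  (forall x, normc (f x) <= G x) -> normc (cint f) <= 2 * \int[mu]_x G x.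
Proof.
move=> mf gi fG; have [f1 f2] := cintegrable_dominated mf gi fG.
apply: le_trans (normc_leD _) _; rewrite /= mulrDl !mul1r lerD//.
- apply: le_trans (le_normr_Rintegral _ f1) _ => //.
  apply: le_Rintegral => //; first exact: integrable_norm f1.
  by move=> x _; exact: le_trans (ler_Re_normc _) (fG x).
- apply: le_trans (le_normr_Rintegral _ f2) _ => //.
  apply: le_Rintegral => //; first exact: integrable_norm f2.
  by move=> x _; exact: le_trans (ler_Im_normc _) (fG x).
Qed.

Lemma cintegrableD f g : cL1 f -> cL1 g -> cL1 (fun x => f x + g x).
Proof.
move=> [f1 f2] [g1 g2]; split.
- apply: eq_integrable (integrableD _ f1 g1) => //= x _.
  by rewrite cReD.
- apply: eq_integrable (integrableD _ f2 g2) => //= x _.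
  by rewrite cImD.
Qed.

Lemma cintegralD f g : cL1 f -> cL1 g ->
  cint (fun x => f x + g x) = cint f + cint g.
Proof.
move=> [f1 f2] [g1 g2]; apply: complex_ext;
  rewrite ?cReD ?cImD /= -RintegralD//.
- by apply: eq_Rintegral => x _; rewrite cReD.
- by apply: eq_Rintegral => x _; rewrite cImD.
Qed.

Lemma integrableZ (c : R) (h : R -> R) : L1 h -> L1 (fun x => c * h x).
Proof. by move=> hi; exact: (integrableZl measurableT c hi). Qed.

Lemma cintegrableZ (c : R[i]) f : cL1 f -> cL1 (fun x => c * f x).
Proof.
move=> [f1 f2]; split.
- apply: eq_integrable
    (integrableB _ (integrableZ (Re c) f1) (integrableZ (Im c) f2)) => //= x _.
  by rewrite cReM.
- apply: eq_integrable
    (integrableD _ (integrableZ (Re c) f2) (integrableZ (Im c) f1)) => //= x _.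
  by rewrite cImM.
Qed.

Lemma cintegralZ (c : R[i]) f : cL1 f ->
  cint (fun x => c * f x) = c * cint f.
Proof.
move=> [f1 f2]; apply: complex_ext; rewrite ?cReM ?cImM /= -!RintegralZl//.
- rewrite -RintegralB//; [|exact: integrableZ|exact: integrableZ].
  by apply: eq_Rintegral => x _; rewrite cReM.
- rewrite -RintegralD//; [|exact: integrableZ|exact: integrableZ].
  by apply: eq_Rintegral => x _; rewrite cImM.
Qed.

Lemma cintegral_real (h : R -> R) :
  cint (fun x => (h x)%:C) = (\int[mu]_x h x)%:C.
Proof. by apply: complex_ext => //=; rewrite /Rintegral integral0. Qed.

(** Some sections may fail to be integrable: Tonelli makes the integrals of the positive and
    negative parts measurable in [x] as extended reals, and so is [fine] of their difference. *)
Lemma measurable_Rintegral_param (F : R * R -> R) : measurable_fun setT F ->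
  measurable_fun setT (fun x => \int[mu]_y F (x, y)).
Proof.
move=> mF; rewrite /Rintegral; apply: measurableT_comp => //.
under eq_fun do rewrite integralE.
have mE : measurable_fun setT (EFin \o F) by exact/measurable_EFinP.
apply: emeasurable_funB.
- have := @measurable_fun_fubini_tonelli_F _ _ _ _ R mu ((EFin \o F)^\+)%E
    (measurable_funepos mE) (fun=> funepos_ge0 _ _).
  apply: eq_measurable_fun => x _; apply: eq_integral => y _.
  by rewrite !funeposE.
- have := @measurable_fun_fubini_tonelli_F _ _ _ _ R mu ((EFin \o F)^\-)%E
    (measurable_funeneg mE) (fun=> funeneg_ge0 _ _).
  apply: eq_measurable_fun => x _; apply: eq_integral => y _.
  by rewrite !funenegE.
Qed.

Lemma cmeasurable_cintegral (F : R * R -> R[i]) : cmeasurable F ->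
  cmeasurable (fun x => cint (fun y => F (x, y))).
Proof.
move=> [F1 F2]; split.
- exact: (@measurable_Rintegral_param (fun p => Re (F p))).
- exact: (@measurable_Rintegral_param (fun p => Im (F p))).
Qed.

Lemma Rintegral_fubini (F : R * R -> R) :
    (mu \x mu)%E.-integrable setT (EFin \o F) ->
  \int[mu]_x \int[mu]_y F (x, y) = \int[mu]_y \int[mu]_x F (x, y).
Proof.
move=> Fi; have mF : measurable_fun setT F.
  by apply/measurable_EFinP; exact: measurable_int Fi.
rewrite /Rintegral; congr fine.
(* The real-valued inner integral agrees with the extended one wherever the section is integrable,
   that is almost everywhere, so Fubini for extended values applies. *)
transitivity (\int[mu]_x \int[mu]_y (F (x, y))%:E)%E.
  apply: ae_eq_integral => //.
  - apply/measurable_EFinP; exact: measurable_Rintegral_param.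
  - exact: (measurable_fubini_F Fi).
  - have := ae_integrable1 Fi; apply: filterS => x xi _ /=.
    by rewrite fineK//; exact: integrable_fin_num xi.
rewrite (Fubini Fi); apply/esym; apply: ae_eq_integral => //.
- apply/measurable_EFinP.
  apply: (@measurable_Rintegral_param (fun p => F (p.2, p.1))).
  apply: measurableT_comp => //.
  exact: measurable_fun_pair.
- exact: (measurable_fubini_G Fi).
- have := ae_integrable2 Fi; apply: filterS => y yi _ /=.
  by rewrite fineK//; exact: integrable_fin_num yi.
Qed.

Lemma integrable_prod_dominated (F : R * R -> R) (G : R -> R -> R) (A : R -> R)
  :
  measurable_fun setT F -> (forall x y, `|F (x, y)| <= G x y) ->
  (forall x, L1 (G x)) -> (forall x, \int[mu]_y G x y <= A x) -> L1 A ->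
  (mu \x mu)%E.-integrable setT (EFin \o F).
Proof.
move=> mF FG Gi GA Ai.
have mE : measurable_fun setT (EFin \o F) by exact/measurable_EFinP.
apply/(@integrable12ltyP _ _ _ _ R mu mu (EFin \o F) mE) => /=.
have A0 x : 0 <= A x.
  apply: le_trans (GA x); apply: Rintegral_ge0 => y _.
  exact: le_trans (FG x y).
have [_ ] := integrableP _ _ _ Ai; apply: le_lt_trans.
have mn : measurable_fun setT (abse \o (EFin \o F)) by exact: measurableT_comp.
apply: ge0_le_integral => //.
- by move=> x _; exact: integral_ge0.
- exact: (@measurable_fun_fubini_tonelli_F _ _ _ _ R mu (abse \o (EFin \o F))
    mn (fun=> abse_ge0 _)).
- by apply: measurableT_comp => //; exact: measurable_int Ai.
- move=> x _; rewrite /= ger0_norm//.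
  apply: (@le_trans _ _ (\int[mu]_y G x y)%:E); last by rewrite lee_fin.
  rewrite /Rintegral fineK; last exact: (integrable_fin_num measurableT (Gi x)).
  apply: ge0_le_integral => //.
  + apply: (measurableT_comp mn); exact: measurable_pair1.
  + exact: measurable_int (Gi x).
  + by move=> y _; rewrite /= lee_fin.
Qed.

Lemma cintegral_fubini (F : R * R -> R[i]) (G : R -> R -> R) (A : R -> R) :
  cmeasurable F -> (forall x y, normc (F (x, y)) <= G x y) ->
  (forall x, L1 (G x)) -> (forall x, \int[mu]_y G x y <= A x) -> L1 A ->
  cint (fun x => cint (fun y => F (x, y))) =
  cint (fun y => cint (fun x => F (x, y))).
Proof.
move=> [F1 F2] FG Gi GA Ai; apply: complex_ext => /=.
- apply: (@Rintegral_fubini (fun p => Re (F p))).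
  apply: integrable_prod_dominated Gi GA Ai => // x y.
  exact: le_trans (ler_Re_normc _) _.
- apply: (@Rintegral_fubini (fun p => Im (F p))).
  apply: integrable_prod_dominated Gi GA Ai => // x y.
  exact: le_trans (ler_Im_normc _) _.
Qed.

End ComplexIntegrals.

(** * The fundamental theorem of calculus on the real line *)

Section FTC.
Context {R : realType}.
Implicit Types h : R -> R.

Lemma derive_continuous (F f : R -> R) :
  (forall x, is_derive x (1 : R) F (f x)) ->
  continuous F.
Proof.
by move=> dF x; apply/differentiable_continuous/derivable1_diffP/ex_derive.
Qed.

Lemma Rintegral_FTCT (F f : R -> R) (l1 l2 : R) : continuous f -> L1 f ->
    (forall x, is_derive x (1 : R) F (f x)) ->
    F x @[x --> -oo] --> l1 -> F x @[x --> +oo] --> l2 ->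
  \int[mu]_x f x = l2 - l1.
Proof.
move=> cf fi dF Fl1 Fl2; have cF := derive_continuous dF.
have := Rintegral_cvg_itv measurableT fi.
have FnE : \forall n \near \oo,
    \int[mu]_(x in setT `&` `[- n%:R, n%:R]) f x = F n%:R - F (- n%:R).
  near=> n.
  have n0 : (0 : R) < n%:R by near: n; exact: nbhs_infty_gtr.
  rewrite setTI /Rintegral (@continuous_FTC2 _ f F)//.
  - by rewrite (lt_trans _ n0)// oppr_lt0.
  - exact: continuous_subspaceT.
  - split => [x _||]; first exact: ex_derive.
      by apply: cvg_at_right_filter; exact: cF.
    by apply: cvg_at_left_filter; exact: cF.
  - by move=> x _; rewrite derive1E derive_val.
move/(cvg_lim (@Rhausdorff R)) => <-.
apply: (cvg_lim (@Rhausdorff R)).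
have : F n%:R - F (- n%:R) @[n --> \oo] --> l2 - l1.
  apply: cvgB.
    by move/cvg_pinftyP : Fl2; apply; exact: cvgr_idn.
  move/cvg_ninftyP : Fl1; apply; apply/cvgNrNy.
  exact: cvgr_idn.
apply: cvg_trans; apply: near_eq_cvg.
by apply: filterS FnE => n ->.
Unshelve. all: by end_near. Qed.

(** Reflection moves the problem to [[- b, +oo[], where [- F (- x)] is an antiderivative of
    [f (- x)]. *)
Lemma ge0_integral_FTCNy (F f : R -> R) (b l : R) : continuous f ->
  (forall x, 0 <= f x) ->
    (forall x, is_derive x (1 : R) F (f x)) -> F x @[x --> -oo] --> l ->
  (\int[mu]_(x in `]-oo, b]) (f x)%:E = (F b - l)%:E)%E.
Proof.
move=> cf f0 dF Fl; have cF := derive_continuous dF.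
rewrite -(opprK b) ge0_integration_by_substitutionNy//; last first.
  exact: continuous_subspaceT.
have dG x : is_derive x (1 : R) (fun x => - F (- x)) (f (- x)).
  have d1 := is_derive1_comp (dF (- x)) (is_deriveNid x (1 : R)).
  by apply: is_derive_eq (is_deriveN d1) _; rewrite mulrN1 opprK.
have cG := derive_continuous dG.
rewrite (@ge0_continuous_FTC2y _ _ (fun x => - F (- x)) _ (- l)) => //=.
- by rewrite !opprK -EFinD; congr EFin; ring.
- apply: continuous_subspaceT => x; apply: continuous_comp; last exact: cf.
  exact: opp_continuous.
- apply: cvgN; apply/cvgNy_compNP; rewrite /comp.
  exact: Fl.
- by apply: cvg_at_right_filter; exact: cG.
- by move=> x _; rewrite derive1E derive_val.
Qed.

Lemma cvg0_expR_abs h (C s : R) : 0 < s ->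
    (forall u, `|h u| <= C * expR (- s * `|u|)) ->
  h u @[u --> -oo] --> (0 : R) /\ h u @[u --> +oo] --> (0 : R).
Proof.
move=> s0 hC.
have key : C * expR (- s * u) @[u --> +oo] --> (0 : R).
  rewrite -(mulr0 C); apply: cvgM; first exact: cvg_cst.
  rewrite (_ : (fun x => expR (- s * x)) = (fun z => expR (- z)) \o
    (fun z => s * z)).
    apply: (@cvg_comp _ _ _ _ _ _ (pinfty_nbhs R)); last exact: cvgr_expR.
    exact: gt0_cvgMry.
  by apply: eq_fun => x; rewrite mulNr.
have pos g : (forall u, `|g u| <= C * expR (- s * `|u|)) -> g u @[u --> +oo]
  --> (0 : R).
  move=> gC; apply/norm_cvg0P.
  apply: (@squeeze_cvgr _ _ _ _ (cst 0) (fun u => C * expR (- s * u))) => //;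
    last exact: cvg_cst.
  near=> u; rewrite normr_ge0/= (le_trans (gC u))// ger0_norm//.
split; last exact: pos.
apply/cvgNy_compNP; apply: pos => u /=.
by rewrite (le_trans (hC _))// normrN.
Unshelve. all: by end_near. Qed.

(** The form in which integration by parts is used, for the functional equation of Gamma and for the
    logarithmic kernel: the boundary values of [F] vanish by its decay. *)
Lemma cintegral_derive0 (F f : R -> R[i]) (C s : R) : 0 < s ->
    (forall u, normc (F u) <= C * expR (- s * `|u|)) -> cL1 f ->
    continuous (fun u => Re (f u)) -> continuous (fun u => Im (f u)) ->
    (forall u, is_derive u (1 : R) (fun u => Re (F u)) (Re (f u))) ->
    (forall u, is_derive u (1 : R) (fun u => Im (F u)) (Im (f u))) ->
  cint f = 0.
Proof.
move=> s0 FC [f1 f2] c1 c2 d1 d2.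
have [a1 a2] := @cvg0_expR_abs (fun u => Re (F u)) C s s0
  (fun u => le_trans (ler_Re_normc _) (FC u)).
have [b1 b2] := @cvg0_expR_abs (fun u => Im (F u)) C s s0
  (fun u => le_trans (ler_Im_normc _) (FC u)).
apply: complex_ext => /=.
- by rewrite (Rintegral_FTCT c1 f1 d1 a1 a2) subrr.
- by rewrite (Rintegral_FTCT c2 f2 d2 b1 b2) subrr.
Qed.

Lemma is_derive_Re_cexp (a b : R -> R) (da db x : R) :
  is_derive x (1 : R) a da -> is_derive x (1 : R) b db ->
  is_derive x (1 : R) (fun u => Re (cexp (a u +i* b u)))
    (Re ((da +i* db) * cexp (a x +i* b x))).
Proof.
move=> Da Db /=; apply: is_derive_eq.
rewrite /GRing.scale/=; ring.
Qed.

Lemma is_derive_Im_cexp (a b : R -> R) (da db x : R) :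
  is_derive x (1 : R) a da -> is_derive x (1 : R) b db ->
  is_derive x (1 : R) (fun u => Im (cexp (a u +i* b u)))
    (Im ((da +i* db) * cexp (a x +i* b x))).
Proof.
move=> Da Db /=; apply: is_derive_eq.
rewrite /GRing.scale/=; ring.
Qed.

Implicit Types f g : R -> R[i].

Definition ccontinuous (f : R -> R[i]) :=
  continuous (fun x => Re (f x)) /\ continuous (fun x => Im (f x)).

Lemma ccontinuous_measurable f : ccontinuous f -> cmeasurable f.
Proof. by move=> [c1 c2]; split; exact: continuous_measurable_fun. Qed.

Lemma ccontinuous_cst (c : R[i]) : ccontinuous (fun=> c).
Proof. by split => x; exact: cst_continuous. Qed.

Lemma ccontinuous_real (a : R -> R) : continuous a -> ccontinuous
  (fun x => (a x)%:C).
Proof. by move=> ca; split => // x; exact: cst_continuous. Qed.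

Lemma ccontinuous_id : ccontinuous (fun x : R => x%:C).
Proof. by split => x; [exact: cvg_id|exact: cst_continuous]. Qed.

Lemma ccontinuousD f g : ccontinuous f -> ccontinuous g ->
  ccontinuous (fun x => f x + g x).
Proof.
move=> [f1 f2] [g1 g2]; split => x.
- by under eq_fun do rewrite cReD; apply: cvgD; [exact: f1|exact: g1].
- by under eq_fun do rewrite cImD; apply: cvgD; [exact: f2|exact: g2].
Qed.

Lemma ccontinuousM f g : ccontinuous f -> ccontinuous g ->
  ccontinuous (fun x => f x * g x).
Proof.
move=> [f1 f2] [g1 g2]; split => x.
- rewrite (_ : (fun x => Re (f x * g x)) =
    (fun x => Re (f x) * Re (g x) - Im (f x) * Im (g x))); last first.
    by apply/funext => y; rewrite cReM.
  by apply: cvgB; apply: cvgM; [exact: f1|exact: g1|exact: f2|exact: g2].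
- rewrite (_ : (fun x => Im (f x * g x)) =
    (fun x => Re (f x) * Im (g x) + Im (f x) * Re (g x))); last first.
    by apply/funext => y; rewrite cImM.
  by apply: cvgD; apply: cvgM; [exact: f1|exact: g2|exact: f2|exact: g1].
Qed.

Lemma ccontinuousB f g : ccontinuous f -> ccontinuous g ->
  ccontinuous (fun x => f x - g x).
Proof.
move=> cf cg; have := ccontinuousD cf (ccontinuousM (ccontinuous_cst (-1)) cg).
by under eq_fun do rewrite mulN1r.
Qed.

Lemma ccontinuous_exp f : ccontinuous f -> ccontinuous (fun x => cexp (f x)).
Proof.
move=> [f1 f2]; split => x; apply: cvgM.
- by apply: continuous_comp; [exact: f1|exact: continuous_expR].
- by apply: continuous_comp; [exact: f2|exact: continuous_cos].
- by apply: continuous_comp; [exact: f1|exact: continuous_expR].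
- by apply: continuous_comp; [exact: f2|exact: continuous_sin].
Qed.

Lemma cintegrable_affine f (a b : R) : 0 < a -> ccontinuous f -> cL1 f ->
  cL1 (fun x => f (a * x + b)).
Proof.
move=> a0 [c1 c2] [f1 f2]; split.
- exact: (@integrable_affine _ (fun x => Re (f x))).
- exact: (@integrable_affine _ (fun x => Im (f x))).
Qed.

Lemma cintegral_affine f (a b : R) : 0 < a -> ccontinuous f -> cL1 f ->
  cint (fun x => f (a * x + b)) = a^-1%:C * cint f.
Proof.
move=> a0 [c1 c2] [f1 f2]; apply: complex_ext;
  rewrite ?cReM ?cImM /= mul0r ?subr0 ?addr0.
- exact: (@Rintegral_affine _ (fun x => Re (f x))).
- exact: (@Rintegral_affine _ (fun x => Im (f x))).
Qed.

End FTC.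

(** * The Gamma function and the beta integral *)

Section Gamma.
Context {R : realType}.

(** Euler's integrand [x^(z-1) exp(-x) dx] at [x = expR u]; the Jacobian raises the exponent from
    [z - 1] to [z]. *)
Definition gamma_kernel (z : R[i]) (u : R) : R[i] :=
  cexp (z * u%:C - (expR u)%:C).

Lemma normc_gamma_kernel z u :
  normc (gamma_kernel z u) = expR (Re z * u - expR u).
Proof. by rewrite normc_cexp; congr expR; case: z => a b /=; ring. Qed.

Lemma gamma_kernelE (a b u : R) :
  gamma_kernel (a +i* b) u = cexp ((a * u - expR u) +i* (b * u)).
Proof. by rewrite /gamma_kernel; congr cexp; apply: complex_ext => /=;
  ring. Qed.

Lemma expR_subexp_le (s : R) : 0 < s ->
  {C | forall u, expR (s * u - expR u) <= C * expR (- s * `|u|)}.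
Proof.
(* For [u >= 0] one needs a bound on [2 s u - expR u], whose maximum, at [u = ln (2 s)], is
   [- 2 s (1 - ln (2 s))]. The absolute value makes the constant at least 1, as the case [u < 0]
   requires. *)
move=> s0; exists (expR `|2 * s * (1 - ln (2 * s))|) => u.
rewrite -expRD ler_expR; have [u0|u0] := leP 0 u.
  have s20 : 2 * s \in Num.pos by rewrite posrE mulr_gt0.
  have : 2 * s * (1 + (u - ln (2 * s))) <= expR u.
    rewrite -[u in leRHS](subrK (ln (2 * s))) expRD lnK// mulrC ler_pM2r
      -?posrE//.
    exact: expR_ge1Dx.
  have := ler_norm (- (2 * s * (1 - ln (2 * s)))); rewrite normrN.
  by rewrite (ger0_norm u0); nra.
rewrite (ltr0_norm u0) mulrNN.
have := normr_ge0 (2 * s * (1 - ln (2 * s))); have := expR_ge0 u; lra.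
Qed.

Lemma continuous_expR_subexp (s : R) : continuous
  (fun u => expR (s * u - expR u)).
Proof.
apply: (@derive_continuous _ _ (fun u => (s - expR u) * expR (s * u - expR u)))
  => x.
by apply: is_derive_eq; rewrite /GRing.scale/=; ring.
Qed.

Lemma integrable_expR_subexp (s : R) : 0 < s -> L1
  (fun u => expR (s * u - expR u)).
Proof.
move=> s0; have [C HC] := expR_subexp_le s0.
apply: integrable_dominated (integrableZ C (integrable_expR_abs s0)) _.
  by apply: continuous_measurable_fun; exact: continuous_expR_subexp.
by move=> u; rewrite ger0_norm ?expR_ge0.
Qed.

Lemma ccontinuous_gamma_kernel z : ccontinuous (gamma_kernel z).
Proof.
apply: ccontinuous_exp; apply: ccontinuousB; last first.
  by apply: ccontinuous_real; exact: continuous_expR.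
by apply: ccontinuousM; [exact: ccontinuous_cst|exact: ccontinuous_id].
Qed.

Lemma cmeasurable_gamma_kernel z : cmeasurable (gamma_kernel z).
Proof. exact/ccontinuous_measurable/ccontinuous_gamma_kernel. Qed.

Lemma cintegrable_gamma_kernel z : 0 < Re z -> cL1 (gamma_kernel z).
Proof.
move=> z0; apply: cintegrable_dominated (integrable_expR_subexp z0) _.
  exact: cmeasurable_gamma_kernel.
by move=> u; rewrite normc_gamma_kernel.
Qed.

(** An antiderivative of the kernel at [z = 1]; [expR (u - expR u)] is the density of the logarithm
    of a standard exponential variable. *)
Lemma is_derive_gumbel (u : R) :
  is_derive u (1 : R) (fun u => - expR (- expR u)) (expR (u - expR u)).
Proof. by apply: is_derive_eq; rewrite /GRing.scale/= expRD; ring. Qed.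

Lemma cvgNy_gumbel : - expR (- expR u) @[u --> (-oo : set_system R)] --> -
  (1 : R).
Proof.
apply: cvgN; rewrite -expR0 -oppr0.
apply: continuous_cvg; first exact: continuous_expR.
by apply: cvgN; apply/cvgNy_compNP; exact: cvgr_expR.
Qed.

Lemma cvgy_gumbel : - expR (- expR u) @[u --> (+oo : set_system R)] --> (0 : R).
Proof.
rewrite -oppr0; apply: cvgN.
apply: (@cvg_comp _ _ _ (@expR R) (fun u => expR (- u)) _ (pinfty_nbhs R));
  last exact: cvgr_expR.
apply/cvgryPge => M; near=> u; apply: le_trans (expR_ge1Dx u).
near: u; exists M; split; [exact: num_real|move=> y /ltW My].
by rewrite (le_trans My)// lerDr.
Unshelve. all: by end_near. Qed.

(** The exponential density [f] and the density [q] of its logarithm both give the ray up to [x > 0]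
    the mass [1 - expR (- x)]. Euler's substitution is thus a change of law, with [x^(z-1)] as test
    function. *)
Lemma euler_integralE (z : R[i]) : 0 < Re z -> euler_integral z = cint
  (gamma_kernel z).
Proof.
move=> z0.
pose f (x : R) := if 0 < x then expR (- x) else 0.
pose q (u : R) := expR (u - expR u).
have f0 x : 0 <= f x by rewrite /f; case: ifP => // _; exact: expR_ge0.
have q0 u : 0 <= q u by exact: expR_ge0.
have mf : measurable_fun setT f.
  by apply: measurable_fun_ifT => //; [exact: measurable_fun_ltr|
    apply: measurableT_comp => //; exact: measurableT_comp].
have cq : continuous q.
  move=> u; have := @continuous_expR_subexp 1 u.
  by under [in X in X -> _]eq_fun do rewrite mul1r.
have mq : measurable_fun setT q by exact: continuous_measurable_fun.
have fqE (x : R) : (\int[mu]_(y in `]-oo, x]) (f y)%:E =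
    (if 0 < x then 1 - expR (- x) else 0)%:E)%E.
  case: ifPn => [x0|]; last first.
    rewrite -leNgt => x0; apply: integral0_eq => y /=; rewrite in_itv/= => yx.
    by rewrite /f ltNge (le_trans yx).
  transitivity (\int[mu]_(y in `]0%R, x]) (expR (- y))%:E)%E.
    rewrite integral_mkcond [RHS]integral_mkcond; apply: eq_integral => y _.
    rewrite !patchE !mem_setE !in_itv/= /f.
    by case: ltP => y0; case: (y <= x).
  have mexp : measurable_fun setT (fun y : R => (expR (- y))%:E).
    by apply/measurable_EFinP; apply: measurableT_comp => //;
      exact: measurableT_comp.
  rewrite integral_itv_obnd_cbnd; last exact: measurable_funTS.
  have dF (y : R) : is_derive y (1 : R) (fun y => - expR (- y)) (expR (- y)).
    by apply: is_derive_eq; rewrite /GRing.scale/=; ring.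
  have cF := derive_continuous dF.
  rewrite (@continuous_FTC2 _ _ (fun y => - expR (- y)))//.
  - by rewrite oppr0 expR0 -EFinB; congr EFin; ring.
  - apply: continuous_subspaceT => y; apply: continuous_comp;
      last exact: continuous_expR.
    exact: opp_continuous.
  - split => [y _||]; first exact: ex_derive.
      by apply: cvg_at_right_filter; exact: cF.
    by apply: cvg_at_left_filter; exact: cF.
  - by move=> y _; rewrite derive1E derive_val.
have qE (x : R) : (\int[mu]_(w in [set w | (expR w <= x)%R]) (q w)%:E =
    (if 0 < x then 1 - expR (- x) else 0)%:E)%E.
  case: ifPn => [x0|]; last first.
    rewrite -leNgt => x0; rewrite (_ : [set w | _] = set0) ?integral_set0//.
    apply/seteqP; split => // w /= wx.
    by have := expR_gt0 w; rewrite ltNge (le_trans wx).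
  rewrite (_ : [set w | _] = `]-oo, ln x]%classic); last first.
    by apply/seteqP; split => w /=; rewrite in_itv/= -[w <= ln x]ler_expR lnK.
  by rewrite (ge0_integral_FTCNy _ cq q0 is_derive_gumbel cvgNy_gumbel) lnK//
    opprK addrC.
have fin x : (\int[mu]_(y in `]-oo, x]) (f y)%:E < +oo)%E by rewrite fqE ltry.
have fq x : (\int[mu]_(y in `]-oo, x]) (f y)%:E =
  \int[mu]_(w in [set w | (expR w <= x)%R]) (q w)%:E)%E by rewrite fqE qE.
pose h x := rcpow x (z - 1).
have mh : cmeasurable h.
  apply: cmeasurable_exp; apply: cmeasurableM; first exact: cmeasurable_cst.
  by apply: cmeasurable_real; exact: measurable_ln.
have hq u : h (expR u) * (q u)%:C = gamma_kernel z u.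
  rewrite /h /rcpow /q -cexp_real -cexpD expRK; congr cexp.
  by case: z {z0 h mh} => a b; apply: complex_ext => /=; ring.
have hf x : h x * (f x)%:C =
  (if 0 < x then rcpow x (z - 1) * (expR (- x))%:C else 0).
  by rewrite /h /f; case: ifPn => x0 //; rewrite mulr0.
have [k1 k2] := cintegrable_gamma_kernel z0.
(* [p] stands for the real or the imaginary part; its compatibility with real factors lets both be
   treated at once. *)
have key (p : R[i] -> R) : (forall (w : R[i]) (r : R), p (w * r%:C) = p w * r)
  -> p 0 = 0 ->
    measurable_fun setT (fun x => p (h x)) -> L1
      (fun u => p (gamma_kernel z u)) ->
    \int[mu]_(x in `]0, +oo[) p (rcpow x (z - 1) * (expR (- x))%:C) =
      \int[mu]_u p (gamma_kernel z u).
  move=> pM p0 mp pi.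
  transitivity (\int[mu]_x (p (h x) * f x)).
    rewrite Rintegral_mkcond; apply: eq_Rintegral => x _.
    rewrite -pM hf patchE.
    by rewrite (_ : (x \in `]0, +oo[%classic) = (0 < x));
      [case: ifP|rewrite mem_setE in_itv/= andbT].
  rewrite (Rintegral_law mf f0 mq q0 _ fin fq mp)//.
  - by apply: eq_Rintegral => u _; rewrite -pM hq.
  - apply/(integrable_law mf f0 mq q0 _ fin fq mp) => //.
    by apply: eq_integrable pi => //= u _; rewrite -pM hq.
rewrite /euler_integral /cintegral; congr (_ +i* _).
- by apply: (key (@complex.Re R)) => //;
    [move=> w r; rewrite cReM /=; ring|case: mh].
- by apply: (key (@complex.Im R)) => //;
    [move=> w r; rewrite cImM /=; ring|case: mh].
Qed.

Lemma cGammaE (z : R[i]) : 0 < Re z -> cGamma z = cint (gamma_kernel z).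
Proof.
by move=> z0; rewrite /cGamma /gamma_shift z0 big_ord0 divr1 addr0
  euler_integralE.
Qed.

(** The kernel at [z] has derivative [z - expR u] times itself, so [z Gamma z - Gamma (z + 1)] is
    the integral of an exact derivative. *)
Lemma cGammaS (z : R[i]) : 0 < Re z -> cGamma (z + 1) = z * cGamma z.
Proof.
move=> z0; have z10 : 0 < Re (z + 1) by rewrite cReD /= addr_gt0.
rewrite !cGammaE//; have [C HC] := expR_subexp_le z0.
have kz := cintegrable_gamma_kernel z0;
  have kz1 := cintegrable_gamma_kernel z10.
apply/esym/eqP; rewrite -subr_eq0 -mulN1r; apply/eqP.
rewrite -!cintegralZ// -cintegralD; [|exact: cintegrableZ..].
have gS u : z * gamma_kernel z u + -1 * gamma_kernel (z + 1) u =
    (z - (expR u)%:C) * gamma_kernel z u.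
  rewrite mulrBl mulN1r; congr (_ - _).
  rewrite -cexp_real -cexpD; congr cexp; rewrite mulrDl mul1r; ring.
have cont : ccontinuous
  (fun u => z * gamma_kernel z u + -1 * gamma_kernel (z + 1) u).
  by apply: ccontinuousD; apply: ccontinuousM;
    [exact: ccontinuous_cst|exact: ccontinuous_gamma_kernel
    |exact: ccontinuous_cst|exact: ccontinuous_gamma_kernel].
apply: (@cintegral_derive0 _ (gamma_kernel z) _ C (Re z) z0).
- by move=> u; rewrite normc_gamma_kernel.
- by apply: cintegrableD; exact: cintegrableZ.
- by have [] := cont.
- by have [] := cont.
- move=> u; rewrite gS; case: z {z0 z10 HC kz kz1 gS cont} => a b.
  under eq_fun do rewrite gamma_kernelE.
  rewrite gamma_kernelE (_ : a +i* b - (expR u)%:C = (a - expR u) +i* b).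
    by apply: is_derive_Re_cexp; apply: is_derive_eq; rewrite /GRing.scale/=;
      ring.
  by apply: complex_ext => /=; ring.
- move=> u; rewrite gS; case: z {z0 z10 HC kz kz1 gS cont} => a b.
  under eq_fun do rewrite gamma_kernelE.
  rewrite gamma_kernelE (_ : a +i* b - (expR u)%:C = (a - expR u) +i* b).
    by apply: is_derive_Im_cexp; apply: is_derive_eq; rewrite /GRing.scale/=;
      ring.
  by apply: complex_ext => /=; ring.
Qed.

(** * The beta integral *)

Definition softplus (w : R) : R := ln (1 + expR w).

Lemma expR_softplus w : expR (softplus w) = 1 + expR w.
Proof. by rewrite lnK// posrE addr_gt0// expR_gt0. Qed.

Lemma continuous_softplus : continuous softplus.
Proof.
move=> w; apply: (@continuous_comp _ _ _ (fun w : R => 1 + expR w) (@ln R)).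
  by apply: cvgD; [exact: cvg_cst|exact: continuous_expR].
by apply: continuous_ln; rewrite addr_gt0// expR_gt0.
Qed.

(** The integrand [x^(b-1) (1 + x)^(-(a+b)) dx] of Euler's beta function at [x = expR w]. *)
Definition beta_kernel (a b : R[i]) (w : R) : R[i] :=
  cexp (b * w%:C - (a + b) * (softplus w)%:C).

(** The exponents combine because [expR u + expR (w + u) = expR (u + softplus w)]. The factors [1 *]
    match the form of the affine substitution lemmas. *)
Lemma gamma_kernel_mul a b (u w : R) :
  gamma_kernel a u * gamma_kernel b (1 * w + u) =
  beta_kernel a b w * gamma_kernel (a + b) (1 * u + softplus w).
Proof.
rewrite /gamma_kernel /beta_kernel -!cexpD !mul1r.
congr cexp; rewrite !expRD expR_softplus.
case: a b => a1 a2 [b1 b2]; apply: complex_ext => /=; ring.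
Qed.

Lemma softplus_ge0 w : 0 <= softplus w.
Proof. by rewrite ln_ge0// lerDl expR_ge0. Qed.

Lemma softplus_ge w : w <= softplus w.
Proof. by rewrite -ler_expR expR_softplus lerDr. Qed.

Lemma normc_beta_kernel a b w : normc (beta_kernel a b w) =
  expR (Re b * w - (Re a + Re b) * softplus w).
Proof.
by rewrite normc_cexp; congr expR; case: a b => a1 a2 [b1 b2] /=; ring.
Qed.

(** For [w >= 0], [softplus w >= w] leaves at most [- a w] in the exponent; for [w < 0],
    [softplus w >= 0] leaves at most [b w]. *)
Lemma expR_softplus_le (a b w : R) : 0 < a -> 0 < b ->
  expR (b * w - (a + b) * softplus w) <= expR (- Num.min a b * `|w|).
Proof.
move=> a0 b0; rewrite ler_expR; set m := Num.min a b.
have ma : m <= a by rewrite ge_min lexx.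
have mb : m <= b by rewrite ge_min lexx orbT.
have s0 := softplus_ge0 w; have sw := softplus_ge w.
have [w0|w0] := leP 0 w.
  by rewrite (ger0_norm w0); nra.
by rewrite (ltr0_norm w0); nra.
Qed.

Lemma ccontinuous_beta_kernel a b : ccontinuous (beta_kernel a b).
Proof.
apply: ccontinuous_exp; apply: ccontinuousB; apply: ccontinuousM;
  try exact: ccontinuous_cst.
  exact: ccontinuous_id.
by apply: ccontinuous_real; exact: continuous_softplus.
Qed.

Lemma cintegrable_beta_kernel a b : 0 < Re a -> 0 < Re b -> cL1
  (beta_kernel a b).
Proof.
move=> a0 b0; have m0 : 0 < Num.min (Re a) (Re b) by rewrite lt_min a0.
apply: cintegrable_dominated (integrable_expR_abs m0) _.
  exact/ccontinuous_measurable/ccontinuous_beta_kernel.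
by move=> w; rewrite normc_beta_kernel expR_softplus_le.
Qed.

(** Fubini for the product of two kernels: integrating over [w] first, a translation by [u] gives
    [Gamma b]; integrating over [u] first, a translation by [softplus w] gives [Gamma (a + b)]. *)
Lemma cGammaM (a b : R[i]) : 0 < Re a -> 0 < Re b ->
  cGamma a * cGamma b = cGamma (a + b) * cint (beta_kernel a b).
Proof.
move=> a0 b0; have ab0 : 0 < Re (a + b) by rewrite cReD addr_gt0.
have ka := cintegrable_gamma_kernel a0.
have kb := cintegrable_gamma_kernel b0.
have kab := cintegrable_gamma_kernel ab0.
have cb := ccontinuous_gamma_kernel b.
have cab := ccontinuous_gamma_kernel (a + b).
pose F (p : R * R) := gamma_kernel a p.1 * gamma_kernel b (1 * p.2 + p.1).
transitivity (cint (fun u => cint (fun w => F (u, w)))).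
  rewrite cGammaE// mulrC -cintegralZ//; apply: eq_cintegral => u.
  rewrite /F /= cintegralZ; last exact: cintegrable_affine.
  by rewrite cintegral_affine// invr1 mul1r cGammaE// mulrC.
have rb := integrable_expR_subexp b0.
have crb : continuous (fun u => expR (Re b * u - expR u)) by exact:
  continuous_expR_subexp.
rewrite (@cintegral_fubini _ F
  (fun u w =>
    expR (Re a * u - expR u) * expR (Re b * (1 * w + u) - expR (1 * w + u)))
  (fun u => (\int[mu]_w expR (Re b * w - expR w)) * expR (Re a * u - expR u))).
- rewrite mulrC cGammaE// -[RHS]mulrC -cintegralZ;
    last exact: cintegrable_beta_kernel.
  apply: eq_cintegral => w; rewrite /F /=.
  under eq_cintegral do rewrite gamma_kernel_mul.
  rewrite cintegralZ; last exact: cintegrable_affine.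
  by rewrite cintegral_affine// invr1 mul1r mulrC.
- apply: cmeasurableM.
    exact: (cmeasurable_comp (cmeasurable_gamma_kernel a)).
  apply: (cmeasurable_comp (cmeasurable_gamma_kernel b)).
  by apply: measurable_funD => //; exact: measurable_funM.
- by move=> u w; rewrite /F Normc.normcM !normc_gamma_kernel.
- by move=> u; apply: integrableZ;
    exact: (@integrable_affine _ _ 1 u ltr01 crb rb).
- move=> u; rewrite RintegralZl//;
    last exact: (@integrable_affine _ _ 1 u ltr01 crb rb).
  by rewrite (Rintegral_affine u ltr01 crb rb) invr1 mul1r mulrC.
- by apply: integrableZ; exact: integrable_expR_subexp.
Qed.

(** * Gamma on the positive axis and the absence of zeros *)

Definition rGamma (s : R) : R := \int[mu]_u expR (s * u - expR u).

Lemma cGamma_real (s : R) : 0 < s -> cGamma s%:C = (rGamma s)%:C.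
Proof.
move=> s0; rewrite cGammaE//= -cintegral_real; apply: eq_cintegral => u.
by rewrite -cexp_real /gamma_kernel; congr cexp; apply: complex_ext => /=; ring.
Qed.

Lemma rGammaS (s : R) : 0 < s -> rGamma (s + 1) = s * rGamma s.
Proof.
move=> s0; have := @cGammaS s%:C s0.
have -> : s%:C + 1 = (s + 1)%:C by rewrite rmorphD.
rewrite !cGamma_real ?addr_gt0// => H.
by have := congr1 (@complex.Re R) H; rewrite cReM /=; lra.
Qed.

Lemma rGamma_gt0 (s : R) : 0 < s -> 0 < rGamma s.
Proof.
move=> s0; have rs := integrable_expR_subexp s0.
(* On [[0, 1]] the exponent [s u - expR u] is at least [- expR 1], so this is a minorant of positive
   integral. *)
have ii : L1 (fun u => expR (- expR 1) * \1_(`[0, 1]%classic : set R) u).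
  apply: integrableZ; exact: (integrable_indic_itv 0 1).
apply: (@lt_le_trans _ _
  (\int[mu]_u (expR (- expR 1) * \1_(`[0, 1]%classic : set R) u))).
  rewrite RintegralZl//; last exact: (integrable_indic_itv 0 1).
  rewrite mulr_gt0 ?expR_gt0// /Rintegral integral_indic// setIT.
  have E : lebesgue_measure (`[(0 : R), 1]%classic : set R) = 1%E.
    by rewrite lebesgue_measure_itv/= lte_fin ltr01 -EFinB subr0.
  by rewrite [X in fine X](_ : _ = 1%E).
apply: le_Rintegral => // u _; rewrite indicE mem_setE in_itv/=.
have [/andP[u0 u1]|] := boolP (0 <= u <= 1); last by rewrite mulr0 expR_ge0.
rewrite mulr1 ler_expR (le_trans (y := - expR u))//.
  by rewrite lerN2 ler_expR.
by rewrite lerDr mulr_ge0// ltW.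
Qed.

Lemma ler_abs_sin (x : R) : `|sin x| <= `|x|.
Proof.
wlog x0 : x / 0 < x.
  move=> H; have [|x0|<-] := ltgtP 0 x; first exact: H.
    by rewrite -normrN -sinN -[leRHS]normrN H// oppr_gt0.
  by rewrite sin0.
have [c _] := @MVT R (@sin R) (@cos R) 0 x x0 (fun x _ => is_derive_sin x)
  (continuous_subspaceT (@continuous_sin R)).
rewrite sin0 !subr0 => ->; rewrite normrM ler_piMl//; exact: cos_max.
Qed.

Lemma cos_ge_quadratic (x : R) : 1 - x ^+ 2 / 2 <= cos x.
Proof.
have -> : cos x = 1 - (sin (x / 2)) ^+ 2 *+ 2.
  by rewrite {1}[x in LHS](splitr x) -mulr2n cos_mulr2n cos2sin2; ring.
have : sin (x / 2) ^+ 2 <= (x / 2) ^+ 2.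
  by rewrite -[leLHS]real_normK ?num_real// -[leRHS]real_normK ?num_real//
    lerXn2r ?nnegrE// ler_abs_sin.
by nra.
Qed.

(** The right side is [4 (expR (x/2) - expR (-x/2))^2]. For [x >= 0] the difference is at least
    [x / 2], since [expR (x/2) >= 1 + x/2] and [expR (-x/2) <= 1]. *)
Lemma sqr_le_expRD (x : R) : x ^+ 2 <= 4 * (expR x + expR (- x) - 2).
Proof.
wlog x0 : x / 0 <= x.
  move=> H; have [|x0] := leP 0 x; first exact: H.
  by have := H (- x); rewrite oppr_ge0 => /(_ (ltW x0));
    rewrite sqrrN opprK addrC [X in X - 2]addrC (addrC _ (- 2)).
have e1 := expR_ge1Dx (x / 2).
have e2 : expR (x / 2) * expR (- (x / 2)) = 1 by rewrite expRxMexpNx_1.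
have e3 : 0 < expR (- (x / 2)) by exact: expR_gt0.
have -> : expR x = expR (x / 2) ^+ 2 by rewrite expr2 -expRD -splitr.
have -> : expR (- x) = expR (- (x / 2)) ^+ 2.
  by rewrite expr2 -expRD -opprD -splitr.
have e4 : expR (- (x / 2)) <= 1 by rewrite expR_le1; lra.
have e5 : x / 2 <= expR (x / 2) - expR (- (x / 2)) by lra.
have : (x / 2) ^+ 2 <= (expR (x / 2) - expR (- (x / 2))) ^+ 2.
  by rewrite lerXn2r ?nnegrE; lra.
move: e2; set p := expR (x / 2); set q := expR _ => e2.
have -> : (p - q) ^+ 2 = p ^+ 2 + q ^+ 2 - 2 * (p * q) by ring.
by rewrite e2 exprMn; lra.
Qed.

(* The real part of [k ^ (- iy) Gamma (k + iy)] is the integral of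
   [expR (k u - expR u) cos (y (u - ln k))]; the quadratic bound on cos and the
   hyperbolic bound on its argument turn this into values of Gamma at
   [k - 1], [k] and [k + 1]. *)
Lemma cGamma_neq0_large (k y : R) : 1 + 2 * y ^+ 2 < k -> cGamma (k +i* y) != 0.
Proof.
move=> ky; have k1 : 1 < k by have := sqr_ge0 y; lra.
have k0 : 0 < k by lra.
have km0 : 0 < k - 1 by lra.
have kp0 : 0 < k + 1 by lra.
have lnk : expR (ln k) = k by rewrite lnK.
have ki := cintegrable_gamma_kernel (z := k +i* y) k0.
suff : 0 < Re (cexp (0 -i* (y * ln k)) * cGamma (k +i* y)).
  by apply: contraTneq => ->; rewrite mulr0 ltxx.
have i0 := integrable_expR_subexp k0.
have im := integrable_expR_subexp km0.
have ip := integrable_expR_subexp kp0.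
rewrite cGammaE// -cintegralZ//.
(* The coefficients come from expanding [1 - 2 y^2 (expR x + expR (- x) - 2)] at [x = u - ln k],
   where [expR x = expR u / k]. *)
apply: (@lt_le_trans _ _ (\int[mu]_u ((1 + 4 * y ^+ 2) * expR (k * u - expR u) +
  (- 2 * y ^+ 2 / k) * expR ((k + 1) * u - expR u) +
  (- 2 * y ^+ 2 * k) * expR ((k - 1) * u - expR u)))).
  rewrite RintegralD//;
    [|exact: (integrableD _ (integrableZ _ i0) (integrableZ _ ip))|exact:
    integrableZ].
  rewrite RintegralD//; [|exact: integrableZ|exact: integrableZ].
  rewrite !RintegralZl// -!/(rGamma _) rGammaS//.
  have := rGammaS km0; rewrite subrK => kE; rewrite kE.
  have gm := rGamma_gt0 km0.
  (* The functional equation reduces the three Gamma values to [rGamma (k - 1)]; the resulting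
     coefficient is positive exactly when [1 + 2 y^2 < k]. *)
  rewrite [X in 0 < X](_ : _ = (k - 1 - 2 * y ^+ 2) * rGamma (k - 1));
    last by field; lra.
  by rewrite mulr_gt0//; lra.
apply: le_Rintegral => //.
- apply: (integrableD _ (integrableD _ (integrableZ _ i0) (integrableZ _ ip))
    (integrableZ _ im)) => //.
- by have [] := cintegrableZ (cexp (0 -i* (y * ln k))) ki.
move=> u _; set x := u - ln k.
have -> : Re (cexp (0 -i* (y * ln k)) * gamma_kernel (k +i* y) u) =
    expR (k * u - expR u) * cos (y * x).
  rewrite gamma_kernelE -cexpD /= add0r; congr (_ * cos _); rewrite /x; ring.
have eu : expR u = k * expR x by rewrite /x expRB lnk; field; lra.
have -> : expR ((k + 1) * u - expR u) = k * expR x * expR (k * u - expR u).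
  by rewrite -eu -expRD; congr expR; ring.
have -> : expR ((k - 1) * u - expR u) = k^-1 * expR (- x) * expR
  (k * u - expR u).
  have -> : (k - 1) * u - expR u = - u + (k * u - expR u) by ring.
  by rewrite expRD; congr (_ * _); rewrite !expRN eu invfM.
set r := expR (k * u - _); have r0 : 0 < r by exact: expR_gt0.
have c1 := cos_ge_quadratic (y * x); have c2 := sqr_le_expRD x.
have -> : (1 + 4 * y ^+ 2) * r + - 2 * y ^+ 2 / k * (k * expR x * r) +
   - 2 * y ^+ 2 * k * (k^-1 * expR (- x) * r) =
   r * (1 - 2 * y ^+ 2 * (expR x + expR (- x) - 2)) by field; lra.
rewrite ler_pM2l//; apply: le_trans c1; rewrite lerD2l lerN2 exprMn.
have := ler_wpM2l (sqr_ge0 y) c2; lra.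
Qed.

(** By the functional equation a zero at [z] would propagate to every [z + m]. The imaginary part
    stays fixed while the real part grows, which ends in the zero-free region of
    [cGamma_neq0_large]. *)
Lemma cGamma_neq0 (z : R[i]) : 0 < Re z -> cGamma z != 0.
Proof.
move=> z0.
have zE (m : nat) : z + m%:R = (Re z + m%:R) +i* Im z.
  by rewrite -(rmorph_nat (real_complex R)); case: z {z0} => a b;
    apply: complex_ext => /=; ring.
pose n := (Num.truncn (1 + 2 * Im z ^+ 2)).+1.
have H m : cGamma z = 0 -> cGamma (z + m%:R) = 0.
  move=> gz; elim: m => [|m IH]; first by rewrite addr0.
  rewrite -natr1 addrA cGammaS ?IH ?mulr0//.
  by rewrite cReD (_ : Re m%:R = m%:R) ?ltr_wpDr//;
    rewrite -(rmorph_nat (real_complex R)).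
apply/eqP => /(H n)/eqP; apply/negP.
rewrite zE; apply: cGamma_neq0_large.
have := truncnS_gt (1 + 2 * Im z ^+ 2); rewrite -/n; lra.
Qed.

Lemma cGamma1 : cGamma (1 : R[i]) = 1.
Proof.
have -> : (1 : R[i]) = (1 : R)%:C by [].
rewrite cGamma_real//; congr (_ %:C); rewrite /rGamma.
have dg (u : R) : is_derive u (1 : R) (fun u => - expR (- expR u))
  (expR (1 * u - expR u)).
  by rewrite mul1r; exact: is_derive_gumbel.
rewrite (Rintegral_FTCT (@continuous_expR_subexp 1)
  (integrable_expR_subexp ltr01)
  dg cvgNy_gumbel cvgy_gumbel).
by rewrite sub0r opprK.
Qed.

End Gamma.

(** * Fourier inversion and the Mellin transform of the logarithm *)

Section Inversion.
Context {R : realType}.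

Lemma Rintegral_dominated_cvg (f_ : nat -> R -> R) (f G : R -> R) :
    (forall n, measurable_fun setT (f_ n)) -> measurable_fun setT f -> L1 G ->
    (forall n x, `|f_ n x| <= G x) -> (forall x, f_ n x @[n --> \oo] --> f x) ->
  \int[mu]_x f_ n x @[n --> \oo] --> \int[mu]_x f x.
Proof.
move=> mf_ mf Gi fG cf.
have [] // := @dominated_convergence _ _ _ mu setT measurableT
  (fun n x => (f_ n x)%:E) (EFin \o f) (EFin \o G).
- by move=> n; apply/measurable_EFinP; exact: mf_.
- exact/measurable_EFinP.
- by apply: aeW => x _; apply: cvg_EFin; [exact: nearW|exact: cf].
- by apply: aeW => x n _; rewrite /= lee_fin.
move=> fi _ H; apply: fine_cvg; rewrite fineK//.
exact: (integrable_fin_num measurableT fi).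
Qed.

Lemma Rintegral_Nyc (f : R -> R) : continuous f -> L1 f ->
  \int[mu]_(x in `]-oo, 0]) f x = \int[mu]_(x in `[0, +oo[) f (- x).
Proof.
move=> cf fi.
have ge0E (g : R -> R) : continuous g -> (forall x, 0 <= g x) ->
    (\int[mu]_(x in `]-oo, 0%R]) (g x)%:E =
      \int[mu]_(x in `[0%R, +oo[) (g (- x))%:E)%E.
  move=> cg g0; have := @ge0_integration_by_substitutionNy R g 0.
  by rewrite oppr0; apply => //; exact: continuous_subspaceT.
have cnf : continuous (fun x => `|f x|).
  by move=> x; apply: continuous_comp; [exact: cf|exact: norm_continuous].
have cpf : continuous (fun x => `|f x| + f x).
  by move=> x; apply: cvgD; [exact: cnf|exact: cf].
have m1 : measurable (`]-oo, (0 : R)] : set R) by [].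
have m2 : measurable (`[(0 : R), +oo[ : set R) by [].
have fi1 : mu.-integrable `]-oo, 0] (EFin \o f) by apply: integrableS fi.
have ni1 : mu.-integrable `]-oo, 0] (EFin \o (fun x => `|f x|)).
  exact: (integrable_norm fi1).
have fi2 : mu.-integrable `[0, +oo[ (EFin \o (fun x => f (- x))).
  apply/integrableP; split.
    apply/measurable_EFinP/measurable_funTS; apply: measurableT_comp => //.
    exact: continuous_measurable_fun.
  have := ge0E _ cnf (fun=> normr_ge0 _); rewrite /= => <-.
  by have [_] := integrableP _ _ _ fi1.
have ni2 := integrable_norm fi2.
have : \int[mu]_(x in `]-oo, 0]) (`|f x| + f x) =
    \int[mu]_(x in `[0, +oo[) (`|f (- x)| + f (- x)).
  rewrite /Rintegral ge0E// => x.
  by rewrite -lerBlDr sub0r ler_normr lexx orbT.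
have : \int[mu]_(x in `]-oo, 0]) `|f x| = \int[mu]_(x in `[0, +oo[) `|f (- x)|.
  by rewrite /Rintegral ge0E.
by rewrite !RintegralD// => ->; exact: addrI.
Qed.

Lemma Rintegral_split0 (f : R -> R) : continuous f -> L1 f ->
  \int[mu]_x f x =
  \int[mu]_(x in `[0, +oo[) f (- x) + \int[mu]_(x in `[0, +oo[) f x.
Proof.
move=> cf fi; rewrite -Rintegral_Nyc//.
rewrite -(Rintegral_itv_obnd_cbnd (r := 0)); last first.
  by apply: integrableS fi.
rewrite -Rintegral_setU//.
- by rewrite -setCitvl setUv.
- by rewrite -setCitvl setUv.
- by rewrite disj_set2E -setCitvl setICr.
Qed.

(** This function serves twice: as the Poisson kernel of the inversion and as the majorant of [K] on
    vertical lines. *)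
Lemma integrable_poisson : L1 (fun x : R => (1 + x ^+ 2)^-1).
Proof.
have c1 : continuous (fun x : R => (1 + x ^+ 2)^-1) by exact:
  continuous_oneDsqrV.
apply/integrableP; split.
  by apply/measurable_EFinP; exact: continuous_measurable_fun.
have p0 (x : R) : 0 <= (1 + x ^+ 2)^-1 by rewrite invr_ge0 addr_ge0// sqr_ge0.
under eq_integral do rewrite /= ger0_norm//.
rewrite ge0_symfun_integralT//; last by move=> x /=; rewrite sqrrN.
rewrite (_ : [set x | 0 <= x] = `[0, +oo[%classic); last first.
  by apply/seteqP; split => x /=; rewrite in_itv/= andbT.
by rewrite integral0y_oneDsqr -EFinM ltry.
Qed.

Lemma Rintegral_poisson : \int[mu]_x (1 + x ^+ 2)^-1 = pi :> R.
Proof.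
have c1 : continuous (fun x : R => (1 + x ^+ 2)^-1) by exact:
  continuous_oneDsqrV.
rewrite Rintegral_split0//; last exact: integrable_poisson.
under eq_Rintegral do rewrite sqrrN.
rewrite /Rintegral integral0y_oneDsqr /=; lra.
Qed.

Lemma continuous_expR_abs (e : R) : continuous (fun y : R => expR (- e * `|y|)).
Proof.
move=> x; apply: continuous_comp; last exact: continuous_expR.
by apply: continuousM; [exact: cst_continuous|exact: norm_continuous].
Qed.

Lemma Rintegral_laplace_cos (e x : R) : 0 < e ->
    mu.-integrable
      `[0, +oo[ (EFin \o (fun y => expR (- e * y) * cos (x * y))) ->
  \int[mu]_(y in
    `[0, +oo[) (expR (- e * y) * cos (x * y)) = e / (e ^+ 2 + x ^+ 2).
Proof.
move=> e0 fi; have d0 : 0 < e ^+ 2 + x ^+ 2 by rewrite ltr_wpDr ?sqr_ge0//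
  exprn_gt0.
pose F y :=
  (e ^+ 2 + x ^+ 2)^-1 * (expR (- e * y) * (x * sin (x * y) - e * cos (x * y))).
have dF y : is_derive y (1 : R) F (expR (- e * y) * cos (x * y)).
  by apply: is_derive_eq; rewrite /GRing.scale/=; field; lra.
have cE : continuous (fun y => expR (- e * y) * cos (x * y)).
  move=> y; apply: cvgM.
    apply: (continuous_comp (f := fun y => - e * y));
      last exact: continuous_expR.
    by apply: cvgM; [exact: cvg_cst|exact: cvg_id].
  apply: (continuous_comp (f := fun y => x * y)); last exact: continuous_cos.
  by apply: cvgM; [exact: cvg_cst|exact: cvg_id].
rewrite (Rintegral_FTC0y cE fi dF (l := 0)).
  by rewrite /F !mulr0 expR0 sin0 cos0; field; lra.
(* [h] agrees with [F] for [y >= 0] and decays on both sides, so the two-sided decay lemma yields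
   the limit of [F] at [+oo]. *)
pose h y :=
  (e ^+ 2 + x ^+ 2)^-1 *
  (expR (- e * `|y|) * (x * sin (x * y) - e * cos (x * y))).
have hb y : `|h y| <= (e ^+ 2 + x ^+ 2)^-1 * (`|x| + e) * expR (- e * `|y|).
  rewrite /h !normrM (ger0_norm (expR_ge0 _)) normfV (gtr0_norm d0).
  rewrite -mulrA ler_pM2l ?invr_gt0// mulrC ler_wpM2r ?expR_ge0//.
  apply: le_trans (ler_normB _ _) _; rewrite !normrM (gtr0_norm e0) lerD//.
  - by rewrite ler_piMr ?sin_max.
  - by rewrite ler_piMr ?cos_max// ltW.
have [_] := cvg0_expR_abs e0 hb.
apply: cvg_trans; apply: near_eq_cvg; near=> y.
by rewrite /F /h ger0_norm.
Unshelve. all: by end_near. Qed.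

(** The real part is even and gives twice the Laplace transform of the cosine; the imaginary part is
    odd and cancels. *)
Lemma fourier_expR_abs (e x : R) : 0 < e ->
  cint (fun y => (expR (- e * `|y|))%:C * cexp (0 +i* (x * y))) =
  (2 * e / (e ^+ 2 + x ^+ 2))%:C.
Proof.
move=> e0; have ei := integrable_expR_abs e0.
have lin : continuous (fun y => x * y).
  by move=> y; apply: cvgM; [exact: cvg_cst|exact: cvg_id].
have cc : ccontinuous (fun y => (expR (- e * `|y|))%:C * cexp (0 +i* (x * y))).
  apply: ccontinuousM.
    by apply: ccontinuous_real; exact: continuous_expR_abs.
  by apply: ccontinuous_exp; split => //= y; exact: cst_continuous.
have [c1 c2] := cc.
have [i1 i2] : cL1 (fun y => (expR (- e * `|y|))%:C * cexp (0 +i* (x * y))).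
  apply: cintegrable_dominated ei _; first exact: ccontinuous_measurable.
  by move=> y; rewrite Normc.normcM normc_cexp normc_real expR0 mulr1 ger0_norm.
have d0 : 0 < e ^+ 2 + x ^+ 2 by rewrite ltr_wpDr ?sqr_ge0// exprn_gt0.
have S1 : {in
  `[0, +oo[, forall y, Re ((expR (- e * `|- y|))%:C * cexp (0 +i* (x * - y))) =
    expR (- e * y) * cos (x * y)}.
  move=> y; rewrite in_itv/= andbT => y0.
  by rewrite normrN ger0_norm// expR0 !mul1r mul0r subr0 mulrN cosN.
have S2 : {in
  `[0, +oo[, forall y, Re ((expR (- e * `|y|))%:C * cexp (0 +i* (x * y))) =
    expR (- e * y) * cos (x * y)}.
  move=> y; rewrite in_itv/= andbT => y0.
  by rewrite ger0_norm//= expR0 !mul1r mul0r subr0.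
apply: complex_ext; rewrite [LHS]Rintegral_split0//.
- rewrite (@eq_Rintegral _ _ _ mu _ (fun y => expR (- e * y) * cos (x * y)));
    last first.
    by move=> y; rewrite mem_setE => /S1.
  rewrite [X in _ + X](@eq_Rintegral _ _ _ mu _
    (fun y => expR (- e * y) * cos (x * y))); last first.
    by move=> y; rewrite mem_setE => /S2.
  rewrite Rintegral_laplace_cos//; first by rewrite /= -mulrDl; congr (_ / _);
    lra.
  have := @integrableS _ _ _ mu _
    `[0, +oo[ _ measurableT (measurable_itv _) (@subsetT _ _) i1.
  by apply: eq_integrable => //= y; rewrite mem_setE => yi; congr EFin;
    exact: S2.
- rewrite (@eq_Rintegral _ _ _ mu _
    (fun y => -1 * Im ((expR (- e * `|y|))%:C * cexp (0 +i* (x * y)))));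
    last first.
    by move=> y _; rewrite normrN /= expR0 mulrN sinN cosN; ring.
  rewrite RintegralZl//; first by rewrite /= mulN1r addNr.
  by apply: integrableS i2.
Qed.

Definition fourier (g : R -> R) (y : R) : R[i] :=
  cint (fun v => (g v)%:C * cexp (0 +i* (y * v))).

Lemma cvgn_Re_Im_unique (w_ : nat -> R[i]) (w w' : R[i]) :
  (fun n => Re (w_ n)) @ \oo --> Re w -> (fun n => Im (w_ n)) @ \oo --> Im w ->
  (fun n => Re (w_ n)) @ \oo --> Re w' -> (fun n => Im (w_ n)) @ \oo --> Im w'
    ->
  w = w'.
Proof.
move=> a b a' b'; apply: complex_ext.
- exact: (cvg_unique (@Rhausdorff R) a a').
- exact: (cvg_unique (@Rhausdorff R) b b').
Qed.

(* Abel summation: the factor [expR (- e |y|)] makes the double integral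
   absolutely convergent, and its Fourier transform is the Poisson kernel. *)
Lemma fourier_inversion (g : R -> R) (B u : R) : continuous g -> L1 g ->
    (forall v, `|g v| <= B) -> cL1 (fourier g) ->
  cint (fun y => fourier g y * cexp (0 +i* (- (y * u)))) = (2 * pi * g u)%:C.
Proof.
move=> cg gi gB Ki.
have mg : measurable_fun setT g by exact: continuous_measurable_fun.
have B0 : 0 <= B by rewrite (le_trans _ (gB 0)).
have mK := cmeasurable_int Ki.
pose G y := fourier g y * cexp (0 +i* (- (y * u))).
have ce : cmeasurable (fun y : R => cexp (0 +i* (- (y * u)))).
  apply: cmeasurable_exp; split; first exact: measurable_cst.
  by apply: measurableT_comp => //; exact: measurable_funM.
have mG : cmeasurable G by exact: cmeasurableM.
have Gi : cL1 G.
  have [k1 k2] := Ki.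
  apply: (@cintegrable_dominated _ _
    (fun y => `|Re (fourier g y)| + `|Im (fourier g y)|)) => //.
    exact: (integrableD _ (integrable_norm k1) (integrable_norm k2)).
  by move=> y; rewrite /G Normc.normcM normc_cexp expR0 mulr1 normc_leD.
pose e (n : nat) : R := n.+1%:R^-1.
have e0 n : 0 < e n by rewrite invr_gt0.
have ecvg : e n @[n --> \oo] --> (0 : R).
  rewrite /e gtr0_cvgV0; first by rewrite cvg_shiftS; exact: cvgr_idn.
  by apply: nearW => n; rewrite ltr0n.
have Acvg (h : R -> R) : L1 h ->
    \int[mu]_y (expR (- e n * `|y|) * h y) @[n --> \oo] --> \int[mu]_y h y.
  move=> hi; have mh : measurable_fun setT h by apply/measurable_EFinP;
    exact: measurable_int hi.
  apply: (Rintegral_dominated_cvg _ _ (integrable_norm hi)) => //.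
  - move=> n; apply: measurable_funM => //.
    by apply: continuous_measurable_fun; exact: continuous_expR_abs.
  - move=> n y; rewrite normrM ger0_norm ?expR_ge0// ler_piMl// expR_le1.
    by rewrite mulNr oppr_le0 mulr_ge0// ltW.
  - move=> y; rewrite -[X in _ --> X]mul1r; apply: cvgM; last exact: cvg_cst.
    rewrite -expR0; apply: continuous_cvg; first exact: continuous_expR.
    rewrite -(mul0r `|y|); apply: cvgM; last exact: cvg_cst.
    by rewrite -oppr0; exact: cvgN.
pose J n := cint (fun y => (expR (- e n * `|y|))%:C * G y).
(* Fubini turns the damped exponential into its transform [2 e / (e^2 + (v - u)^2)]. The
   substitution [v = e w + u] then moves the parameter from the kernel into [g], where boundedness
   and continuity give the limit. *)
have JE n : J n = (\int[mu]_w (g (e n * w + u) * (2 * (1 + w ^+ 2)^-1)))%:C.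
  set en := e n; have en0 : 0 < en by exact: e0.
  pose F (p : R * R) := (expR (- en * `|p.1|))%:C * cexp (0 +i* (- (p.1 * u))) *
    ((g p.2)%:C * cexp (0 +i* (p.1 * p.2))).
  have gci (y : R) : cL1 (fun v => (g v)%:C * cexp (0 +i* (y * v))).
    apply: (@cintegrable_dominated _ _ (fun v => `|g v|)); last 2 first.
    - exact: (integrable_norm gi).
    - by move=> v; rewrite Normc.normcM normc_cexp normc_real expR0 mulr1.
    apply: cmeasurableM; first exact: cmeasurable_real.
    apply: cmeasurable_exp; split; first exact: measurable_cst.
    exact: measurable_funM.
  transitivity (cint (fun y => cint (fun v => F (y, v)))).
    by apply: eq_cintegral => y; rewrite /F /= cintegralZ// /G /fourier; ring.
  rewrite (@cintegral_fubini _ F (fun y v => expR (- en * `|y|) * `|g v|)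
    (fun y => (\int[mu]_v `|g v|) * expR (- en * `|y|))); last 5 first.
  - apply: cmeasurableM; first apply: cmeasurableM.
    + apply: cmeasurable_real; apply: measurableT_comp => //.
      by apply: measurable_funM => //; exact: measurableT_comp.
    + exact: (cmeasurable_comp ce).
    + apply: cmeasurableM; first by apply: cmeasurable_real;
        exact: measurableT_comp.
      apply: cmeasurable_exp; split; first exact: measurable_cst.
      exact: measurable_funM.
  - move=> y v; rewrite /F !Normc.normcM !normc_cexp !normc_real /= expR0
      !mulr1.
    by rewrite ger0_norm ?expR_ge0.
  - by move=> y; apply: integrableZ; exact: (integrable_norm gi).
  - by move=> y; rewrite RintegralZl 1?mulrC//; exact: (integrable_norm gi).
  - by apply: integrableZ; exact: integrable_expR_abs.
  pose f v := g v * (2 * en / (en ^+ 2 + (v - u) ^+ 2)).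
  have d0 v : 0 < en ^+ 2 + (v - u) ^+ 2 by rewrite ltr_wpDr ?sqr_ge0//
    exprn_gt0.
  transitivity (cint (fun v => (f v)%:C)).
    apply: eq_cintegral => v;
      rewrite /f rmorphM /= -fourier_expR_abs// -cintegralZ.
      apply: eq_cintegral => y; rewrite /F /=.
      have -> : cexp (0 +i* ((v - u) * y)) = cexp (0 +i* (- (y * u))) * cexp
        (0 +i* (y * v)).
        by rewrite -cexpD; congr cexp; apply: complex_ext => /=; ring.
      by ring.
    apply: (cintegrable_dominated _ (integrable_expR_abs en0)).
      apply: cmeasurableM.
        by apply: cmeasurable_real; apply: continuous_measurable_fun;
          exact: continuous_expR_abs.
      apply: cmeasurable_exp; split; first exact: measurable_cst.
      exact: measurable_funM.
    by move=> y; rewrite Normc.normcM normc_cexp normc_real expR0 mulr1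
      ger0_norm ?expR_ge0.
  rewrite cintegral_real; congr (_ %:C).
  have cf : continuous f.
    move=> v; apply: cvgM; first exact: cg.
    apply: cvgM; first exact: cvg_cst.
    apply: cvgV; first by rewrite gt_eqF.
    apply: cvgD; first exact: cvg_cst.
    by apply: cvgM; (apply: cvgB; [exact: cvg_id|exact: cvg_cst]).
  have fi : L1 f.
    apply: integrable_dominated (integrableZ (2 / en) (integrable_norm gi)) _.
      exact: continuous_measurable_fun.
    move=> v; rewrite /f normrM mulrC ler_wpM2r// ger0_norm; last first.
      by rewrite divr_ge0 ?mulr_ge0// ltW.
    rewrite -mulrA ler_pM2l// ler_pdivrMr// mulrDr expr2 mulKf ?gt_eqF//.
    by rewrite lerDl mulr_ge0// ?invr_ge0 ?sqr_ge0// ltW.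
  have fE w : en * f (en * w + u) = g (en * w + u) * (2 * (1 + w ^+ 2)^-1).
    rewrite /f addrK exprMn.
    have w0 : 1 + w ^+ 2 != 0 by rewrite gt_eqF// ltr_wpDr ?sqr_ge0.
    have -> : en ^+ 2 + en ^+ 2 * w ^+ 2 = en ^+ 2 * (1 + w ^+ 2) by ring.
    by field; rewrite w0 gt_eqF.
  under [RHS]eq_Rintegral do rewrite -fE.
  rewrite RintegralZl//; last exact: (integrable_affine u en0 cf fi).
  by rewrite Rintegral_affine// mulrA divff ?mul1r// gt_eqF.
have [G1 G2] := Gi.
(* Two limits of one sequence: the damping tends to 1 in the original form of [J n], and the
   argument [e n * w + u] tends to [u] in its Poisson form. *)
apply: (@cvgn_Re_Im_unique J).
- rewrite (_ : (fun _ => _) =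
    (fun n => \int[mu]_y (expR (- e n * `|y|) * Re (G y)))).
    exact: Acvg.
  by apply/funext => n; apply: eq_Rintegral => y _; rewrite cReM /=; ring.
- rewrite (_ : (fun _ => _) =
    (fun n => \int[mu]_y (expR (- e n * `|y|) * Im (G y)))).
    exact: Acvg.
  by apply/funext => n; apply: eq_Rintegral => y _; rewrite cImM /=; ring.
- have -> : Re (2 * pi * g u)%:C = \int[mu]_w (g u * 2 * (1 + w ^+ 2)^-1).
    by rewrite RintegralZl ?Rintegral_poisson//=;
      [ring|exact: integrable_poisson].
  under eq_fun do rewrite JE.
  apply: (@Rintegral_dominated_cvg _ _ (fun w => (B * 2) * (1 + w ^+ 2)^-1)).
  - move=> n; apply: measurable_funM.
      apply: measurableT_comp => //.
      by apply: measurable_funD => //; exact: measurable_funM.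
    apply: measurable_funM => //.
    by apply: continuous_measurable_fun; exact: continuous_oneDsqrV.
  - apply: measurable_funM => //.
    by apply: continuous_measurable_fun; exact: continuous_oneDsqrV.
  - by apply: integrableZ; exact: integrable_poisson.
  - move=> n w; rewrite -mulrA normrM ler_pM// ger0_norm// mulr_ge0// invr_ge0.
    by rewrite addr_ge0// sqr_ge0.
  - move=> w; rewrite -mulrA; apply: cvgM; last exact: cvg_cst.
    apply: continuous_cvg; first exact: cg.
    rewrite -[X in _ --> X]add0r; apply: cvgD; last exact: cvg_cst.
    by rewrite -(mul0r w); apply: cvgM => //; exact: cvg_cst.
- by under eq_fun do rewrite JE; exact: cvg_cst.
Qed.

(** * The logarithmic kernel and its decay *)

Definition log_kernel (t : R[i]) (u : R) : R[i] :=
  (softplus u)%:C * cexp (t * u%:C).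

Lemma softplus_expR_le (tau : R) : -1 < tau < 0 -> {C : R & {s : R | 0 < s &
  forall u, softplus u * expR (tau * u) <= C * expR (- s * `|u|)}}.
Proof.
(* At [+oo], half of the decay rate [- tau] absorbs the linear growth of [softplus]; at [-oo],
   [softplus u <= expR u] leaves the rate [1 + tau]. These are the two terms of the minimum [s]. *)
move=> /andP[tau1 tau0]; pose dl := - tau / 2.
have dl0 : 0 < dl by rewrite /dl; lra.
pose s := Num.min (1 + tau) dl.
have sd : s <= dl by rewrite /s ge_min lexx orbT.
have st : s <= 1 + tau by rewrite /s ge_min lexx.
exists (1 + dl^-1), s => [|u]; first by rewrite /s lt_min dl0 andbT; lra.
have di0 : 0 < dl^-1 by rewrite invr_gt0.
have [u0|u0] := leP 0 u.
  rewrite (ger0_norm u0).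
  have h1 : softplus u <= (1 + dl^-1) * expR (dl * u).
    have h2 : softplus u <= 1 + u.
      rewrite -ler_expR expR_softplus expRD.
      have := @expR_ge1Dx R 1; have : 1 <= expR u by rewrite -expR0 ler_expR.
      by nra.
    apply: (le_trans h2).
    have h3 := expR_ge1Dx (dl * u).
    have h4 : u <= dl^-1 * expR (dl * u).
      by rewrite -ler_pdivrMl ?invr_gt0// invrK; lra.
    have h5 : 1 <= expR (dl * u) by rewrite -expR0 ler_expR mulr_ge0// ltW.
    by rewrite mulrDl mul1r lerD.
  apply: le_trans (_ : (1 + dl^-1) * expR (dl * u) * expR (tau * u) <= _).
    by rewrite ler_wpM2r// expR_ge0.
  rewrite -mulrA ler_pM2l ?addr_gt0// -expRD ler_expR.
  have -> : dl * u + tau * u = - dl * u by rewrite /dl; field.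
  by nra.
rewrite (ltr0_norm u0); apply: le_trans (_ : expR u * expR (tau * u) <= _).
  by rewrite ler_wpM2r ?expR_ge0// /softplus le_ln1Dx//
    (lt_trans _ (expR_gt0 _)).
rewrite -expRD; apply: le_trans (_ : 1 * expR (- s * - u) <= _).
  by rewrite mul1r ler_expR; nra.
by rewrite ler_wpM2r ?expR_ge0// lerDl ltW.
Qed.

Lemma normc_log_kernel t u : normc (log_kernel t u) = softplus u * expR
  (Re t * u).
Proof.
rewrite Normc.normcM normc_real normc_cexp ger0_norm ?softplus_ge0//.
by congr (_ * expR _); case: t => a b /=; ring.
Qed.

Lemma ccontinuous_log_kernel t : ccontinuous (log_kernel t).
Proof.
apply: ccontinuousM; first by apply: ccontinuous_real;
  exact: continuous_softplus.
by apply: ccontinuous_exp; apply: ccontinuousM;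
  [exact: ccontinuous_cst|exact: ccontinuous_id].
Qed.

Lemma cintegrable_log_kernel t : -1 < Re t < 0 -> cL1 (log_kernel t).
Proof.
move=> /softplus_expR_le[C [s s0 HC]].
apply: cintegrable_dominated (integrableZ C (integrable_expR_abs s0)) _.
  exact/ccontinuous_measurable/ccontinuous_log_kernel.
by move=> u; rewrite normc_log_kernel.
Qed.

Lemma is_derive_softplus u : is_derive u (1 : R) softplus
  (expR u / (1 + expR u)).
Proof.
have p0 : 0 < 1 + expR u by rewrite addr_gt0// expR_gt0.
have d1 : is_derive u (1 : R) (fun u => 1 + expR u) (expR u).
  by have := is_deriveD (is_derive_cst (1 : R) u (1 : R)) (is_derive_expR u);
    rewrite add0r.
have d2 := is_derive1_ln p0.
have d3 := is_derive1_comp (f := @ln R) (g := fun u : R => 1 + expR u) d2 d1.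
by apply: is_derive_eq d3 _; rewrite mulrC.
Qed.

(** With [a = - t] and [b = 1 + t] the sum [a + b] is 1, and what remains is the derivative of
    [softplus] times the exponential. *)
Lemma beta_kernel_log (t : R[i]) u : beta_kernel (- t) (1 + t) u =
  (expR u / (1 + expR u))%:C * cexp (t * u%:C).
Proof.
have p0 : 0 < 1 + expR u by rewrite addr_gt0// expR_gt0.
have -> : expR u / (1 + expR u) = expR (u - softplus u).
  by rewrite expRD expRN expR_softplus.
rewrite -cexp_real -cexpD /beta_kernel; congr cexp.
by case: t => a b; apply: complex_ext => /=; ring.
Qed.

(** By the product rule the beta kernel plus [t] times the logarithmic kernel is the derivative of
    the latter, which decays at both ends for [t] in the strip. The factor [Gamma (a + b)] of the
    beta integral is [Gamma 1 = 1]. *)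
Lemma cGamma_log_kernel (t : R[i]) : -1 < Re t < 0 ->
  cGamma (- t) * cGamma (1 + t) = - t * cint (log_kernel t).
Proof.
move=> t10; have /andP[t1 t0] := t10.
have p1 : 0 < Re (- t) by rewrite cReN oppr_gt0.
have p2 : 0 < Re (1 + t) by rewrite cReD /=; lra.
rewrite cGammaM// addrCA addNr addr0 cGamma1 mul1r.
have ki := cintegrable_log_kernel t10.
have bi := cintegrable_beta_kernel p1 p2.
apply/eqP; rewrite mulNr -subr_eq0 opprK -cintegralZ// -cintegralD//;
  last first.
  exact: cintegrableZ.
have [C [s s0 HC]] := softplus_expR_le t10.
apply/eqP; apply: (@cintegral_derive0 _ (log_kernel t) _ C s s0).
- by move=> u; rewrite normc_log_kernel.
- by apply: cintegrableD => //; exact: cintegrableZ.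
- have [+ _] : ccontinuous
    (fun u => beta_kernel (- t) (1 + t) u + t * log_kernel t u).
    apply: ccontinuousD; first exact: ccontinuous_beta_kernel.
    by apply: ccontinuousM;
      [exact: ccontinuous_cst|exact: ccontinuous_log_kernel].
  by [].
- have [_ +] : ccontinuous
    (fun u => beta_kernel (- t) (1 + t) u + t * log_kernel t u).
    apply: ccontinuousD; first exact: ccontinuous_beta_kernel.
    by apply: ccontinuousM;
      [exact: ccontinuous_cst|exact: ccontinuous_log_kernel].
  by [].
- move=> u; case: t {t10 t1 t0 p1 p2 ki bi HC} => a b.
  have E v : (a +i* b) * v%:C = (a * v) +i* (b * v) by apply: complex_ext =>
    /=; ring.
  rewrite beta_kernel_log /log_kernel E.
  rewrite (_ : (fun _ => _) = softplus \*
    (fun v => Re (cexp ((a * v) +i* (b * v))))); last first.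
    by apply/funext => v; rewrite E cReM [X in _ - X](_ : _ = 0) ?subr0// /=
      mul0r.
  have d1 := is_derive_softplus u.
  have d2 : is_derive u (1 : R) (fun v => Re (cexp ((a * v) +i* (b * v))))
      (Re ((a +i* b) * cexp ((a * u) +i* (b * u)))).
    by apply: is_derive_Re_cexp; apply: is_derive_eq; rewrite /GRing.scale/=;
      ring.
  apply: is_derive_eq (is_deriveM d1 d2) _.
  by rewrite /GRing.scale/=; ring.
- move=> u; case: t {t10 t1 t0 p1 p2 ki bi HC} => a b.
  have E v : (a +i* b) * v%:C = (a * v) +i* (b * v) by apply: complex_ext =>
    /=; ring.
  rewrite beta_kernel_log /log_kernel E.
  rewrite (_ : (fun _ => _) = softplus \*
    (fun v => Im (cexp ((a * v) +i* (b * v))))); last first.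
    by apply/funext => v; rewrite E cImM [X in _ + X](_ : _ = 0) ?addr0// /=
      mul0r.
  have d1 := is_derive_softplus u.
  have d2 : is_derive u (1 : R) (fun v => Im (cexp ((a * v) +i* (b * v))))
      (Im ((a +i* b) * cexp ((a * u) +i* (b * u)))).
    by apply: is_derive_Im_cexp; apply: is_derive_eq; rewrite /GRing.scale/=;
      ring.
  apply: is_derive_eq (is_deriveM d1 d2) _.
  by rewrite /GRing.scale/=; ring.
Qed.

Lemma normc_cGamma_le (z : R[i]) : 0 < Re z -> normc (cGamma z) <= 2 * rGamma
  (Re z).
Proof.
move=> z0; rewrite cGammaE//; apply: normc_cintegral_le.
- exact: cmeasurable_gamma_kernel.
- exact: integrable_expR_subexp.
- by move=> u; rewrite normc_gamma_kernel.
Qed.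

Lemma log_kernel_fourier (tau y : R) :
  cint (log_kernel (tau +i* y)) = fourier
    (fun u => softplus u * expR (tau * u)) y.
Proof.
apply: eq_cintegral => u; rewrite /log_kernel rmorphM /= -mulrA -cexp_real
  -cexpD.
by congr (_ * cexp _); apply: complex_ext => /=; ring.
Qed.

Lemma cmeasurable_fourier (g : R -> R) : measurable_fun setT g -> cmeasurable
  (fourier g).
Proof.
move=> mg; apply:
  (@cmeasurable_cintegral _ (fun p => (g p.2)%:C * cexp (0 +i* (p.1 * p.2)))).
apply: cmeasurableM; first by apply: cmeasurable_real; exact: measurableT_comp.
apply: cmeasurable_exp; split; first exact: measurable_cst.
exact: measurable_funM.
Qed.

(** Taken at [a = tau] and [a = 1 + tau], both of absolute value below 1 on the strip, this bounds
    [|t (1 + t)|] from below by a multiple of [1 + y^2]. *)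
Lemma normc_ge_line (a y : R) : a ^+ 2 <= 1 ->
  a ^+ 2 * (1 + y ^+ 2) <= normc (a +i* y) ^+ 2.
Proof.
move=> a1 /=; rewrite sqr_sqrtr ?addr_ge0 ?sqr_ge0//.
have := sqr_ge0 y; nra.
Qed.

(* [-t K t = Gamma (-t) Gamma (1 + t) = Gamma (-t) Gamma (2 + t) / (1 + t)]
   and the Gamma factors are bounded on vertical lines, so [K] decays
   quadratically. *)
Lemma cintegrable_log_kernel_line (tau : R) : -1 < tau < 0 ->
  cL1 (fun y => cint (log_kernel (tau +i* y))).
Proof.
move=> t10; have /andP[t1 t0] := t10.
have csp : continuous (fun u => softplus u * expR (tau * u)).
  move=> u; apply: cvgM; first exact: continuous_softplus.
  apply: (continuous_comp (f := fun y => tau * y)); last exact: continuous_expR.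
  by apply: cvgM; [exact: cvg_cst|exact: cvg_id].
(* The 4 collects the factors 2 of the two Gamma bounds; the denominator is the constant in the
   lower bound on [|t (1 + t)|]. *)
pose c := 4 * rGamma (- tau) * rGamma (2 + tau) / (- tau * (1 + tau)).
apply: (@cintegrable_dominated _ _ (fun y => c * (1 + y ^+ 2)^-1)).
- under eq_fun do rewrite log_kernel_fourier.
  by apply: cmeasurable_fourier; exact: continuous_measurable_fun.
- by apply: integrableZ; exact: integrable_poisson.
move=> y; set t := tau +i* y.
have p1 : 0 < Re (- t) by rewrite cReN oppr_gt0.
have p2 : 0 < Re (1 + t) by rewrite cReD /=; lra.
have q0 : 0 < 1 + y ^+ 2 by rewrite ltr_wpDr// sqr_ge0.
have key : cGamma (- t) * cGamma (2 + t) = - (t * (1 + t)) * cint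
  (log_kernel t).
  have -> : 2 + t = 1 + t + 1 by ring.
  by rewrite cGammaS// mulrCA cGamma_log_kernel//; ring.
have h1 : normc (cGamma (- t) * cGamma (2 + t)) <= 4 * rGamma (- tau) * rGamma
  (2 + tau).
  have p3 : 0 < Re (2 + t) by rewrite cReD /=; lra.
  have r1 : Re (- t) = - tau by [].
  have r3 : Re (2 + t) = 2 + tau by rewrite cReD.
  have := normc_cGamma_le p1; have := normc_cGamma_le p3.
  rewrite r1 r3 => a1 a2;
    rewrite (Normc.normcM (cGamma (- t)) (cGamma (2 + t))).
  apply: le_trans (ler_pM _ _ a2 a1) _; [exact: normc_ge0|exact: normc_ge0|].
  by rewrite le_eqVlt; apply/orP; left; apply/eqP; ring.
have h2 : - tau * (1 + tau) * (1 + y ^+ 2) <= normc (t * (1 + t)).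
  rewrite -(@ler_pXn2r _ 2) ?nnegrE ?normc_ge0//; last first.
    by rewrite !mulr_ge0//; lra.
  rewrite Normc.normcM exprMn [leRHS]exprMn.
  have e1 := @normc_ge_line tau y; have e2 := @normc_ge_line (1 + tau) y.
  have -> : 1 + t = (1 + tau) +i* y by apply: complex_ext => /=; ring.
  apply: le_trans (ler_pM _ _ (e1 _) (e2 _)).
  - by rewrite le_eqVlt; apply/orP; left; apply/eqP; ring.
  - by rewrite mulr_ge0 ?sqr_ge0// ltW.
  - by rewrite mulr_ge0 ?sqr_ge0// ltW.
  - by nra.
  - by nra.
have h3 : 0 < - tau * (1 + tau) by rewrite mulr_gt0//; lra.
rewrite key Normc.normcM normcN in h1.
rewrite /c -mulrA -invfM ler_pdivlMr ?mulr_gt0//.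
by apply: le_trans h1; rewrite mulrC ler_wpM2r// normc_ge0.
Qed.

Lemma log_kernel_inversion (tau v : R) : -1 < tau < 0 ->
  cint (fun y => cint (log_kernel (tau +i* y)) * cexp (0 +i* (- (y * v)))) =
  (2 * pi * (softplus v * expR (tau * v)))%:C.
Proof.
move=> t10; have csp : continuous (fun u => softplus u * expR (tau * u)).
  move=> u; apply: cvgM; first exact: continuous_softplus.
  apply: (continuous_comp (f := fun y => tau * y)); last exact: continuous_expR.
  by apply: cvgM; [exact: cvg_cst|exact: cvg_id].
have [C [s s0 HC]] := softplus_expR_le t10.
have p0 u : 0 <= softplus u * expR (tau * u) by rewrite mulr_ge0 ?softplus_ge0
  ?expR_ge0.
have C0 : 0 <= C.
  have := le_trans (p0 0) (HC 0); by rewrite normr0 mulr0 expR0 mulr1.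
rewrite -(@fourier_inversion _ C v csp).
- by apply: eq_cintegral => y; rewrite log_kernel_fourier.
- apply: integrable_dominated (integrableZ C (integrable_expR_abs s0)) _.
    exact: continuous_measurable_fun.
  by move=> u; rewrite ger0_norm.
- move=> u; rewrite ger0_norm// (le_trans (HC u))// ler_piMr// expR_le1.
  by rewrite mulNr oppr_le0 mulr_ge0// ltW.
- apply: eq_cintegrable (cintegrable_log_kernel_line t10) => y.
  by rewrite log_kernel_fourier.
Qed.

End Inversion.

(** * The law of the maximum and the Mellin-Barnes integral *)

Section SelectionCombining.
Context {R : realType}.
Implicit Types (n : nat) (beta l w : R).

(** In the variable [w = beta (ln x - ln c)] one branch has the logistic law [1 / (1 + expR (- w)) =
    expR (w - softplus w)]; independence gives the maximum its [n]-th power. *)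
Definition sc_log_cdf n w : R := expR (n%:R * (w - softplus w)).

Definition sc_log_pdf n w : R :=
  n%:R * expR (n%:R * w - (n%:R + 1) * softplus w).

Lemma sc_log_pdf_ge0 n w : 0 <= sc_log_pdf n w.
Proof. by rewrite mulr_ge0// expR_ge0. Qed.

Lemma continuous_sc_log_pdf n : continuous (sc_log_pdf n).
Proof.
move=> w; apply: cvgM; first exact: cvg_cst.
apply: (continuous_comp (f := fun w => n%:R * w - (n%:R + 1) * softplus w));
  last exact: continuous_expR.
apply: cvgB; apply: cvgM; try exact: cvg_cst; first exact: cvg_id.
exact: continuous_softplus.
Qed.

Lemma is_derive_sc_log_cdf n w :
  is_derive w (1 : R) (sc_log_cdf n) (sc_log_pdf n w).
Proof.
have p0 : 0 < 1 + expR w by rewrite addr_gt0// expR_gt0.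
have ds := is_derive_softplus w.
have d : is_derive w (1 : R) (fun w => n%:R * (w - softplus w))
  (n%:R * (1 - expR w / (1 + expR w))).
  by apply: is_derive_eq; rewrite /GRing.scale/=; ring.
apply: is_derive_eq (is_derive1_comp (is_derive_expR _) d) _.
rewrite /sc_log_pdf.
have -> : n%:R * w - (n%:R + 1) * softplus w = n%:R * (w - softplus w) -
  softplus w by ring.
by rewrite expRB expR_softplus; field; lra.
Qed.

Lemma cvgNy_sc_log_cdf n : (0 < n)%N ->
  sc_log_cdf n w @[w --> (-oo : set_system R)] --> (0 : R).
Proof.
move=> n0; apply/cvgNy_compNP.
have n1 : (1 : R) <= n%:R by rewrite ler1n.
apply: (@squeeze_cvgr _ _ _ _ (cst 0) (fun w => expR (- w))); last 2 first.
- exact: cvg_cst.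
- exact: cvgr_expR.
near=> w; have w0 : 0 <= w by [].
rewrite /= expR_ge0/= ler_expR.
have := softplus_ge0 (- w); nra.
Unshelve. all: by end_near. Qed.

Lemma sc_log_cdf_cdf n w : sc_log_cdf n w = (1 / (1 + expR (- w))) ^+ n.
Proof.
rewrite /sc_log_cdf expRM_natl; congr (_ ^+ _).
rewrite expRB expR_softplus expRN.
have w0 := expR_gt0 w.
by field; rewrite gt_eqF ?addr_gt0// gt_eqF.
Qed.

(** * The distribution of the maximum *)

Section max.
Context d (T : measurableType d) (P : probability T R).
Variables (n : nat) (c beta : R) (X : 'I_n -> {RV P >-> R}) (f : R -> R).
Hypotheses (n0 : (0 < n)%N) (c0 : 0 < c) (beta0 : 0 < beta).
Hypothesis Xind : mutually_independent X.
Hypothesis Xcdf : forall i x, 0 < x ->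
  cdf (X i) x = (1 / (1 + (x / c) `^ (- beta)))%:E.
Hypothesis fpdf : is_pdf P (selection_combining (fun i t => X i t)) f.

Lemma cdf_selection_combining (w : R) :
  P (selection_combining (fun i t => X i t) @^-1` `]-oo,
    expR (beta^-1 * w + ln c)]) =
  (sc_log_cdf n w)%:E.
Proof.
set x := expR _; have x0 : 0 < x by exact: expR_gt0.
have -> : selection_combining (fun i t => X i t) @^-1` `]-oo, x] =
    \big[setI/setT]_(i in [set: 'I_n]%SET) (X i @^-1` `]-oo, x]%classic).
  rewrite -bigcap_seq_cond; apply/seteqP; split => t /=.
  - rewrite in_itv/= => /bigmax_leP[_ H] i /= _.
    by rewrite in_itv/=; exact: H.
  (* The default 0 of the iterated maximum adds the condition [0 <= x], true because [x] is an
     exponential. *)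
  - move=> H; rewrite in_itv/=; apply/bigmax_leP; split => [|i _];
      first exact: ltW.
    by have := H i; rewrite /= in_itv/=; apply; rewrite mem_index_enum inE.
rewrite Xind//.
rewrite (eq_bigr (fun=> (1 / (1 + expR (- w)))%:E)); last first.
  move=> i _; rewrite -[LHS]/(cdf (X i) x) Xcdf//; congr (1 / (1 + _))%:E.
  rewrite /powR gt_eqF ?divr_gt0//; congr expR.
  rewrite ln_div ?posrE// expRK; field; rewrite gt_eqF//.
rewrite prodEFin; congr EFin.
rewrite prodr_const cardsT card_ord sc_log_cdf_cdf//.
Qed.

Lemma integral_pdf_selection_combining (x : R) :
  (\int[mu]_(y in `]-oo, x]) (f y)%:E =
   \int[mu]_(w in [set w | (expR (beta^-1 * w + ln c) <= x)%R])
     (sc_log_pdf n w)%:E)%E.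
Proof.
have [mf f0 fE] := fpdf.
rewrite -fE//.
have [x0|x0] := leP x 0.
  rewrite (_ : [set w | (expR _ <= x)%R] = set0) ?integral_set0; last first.
    apply/seteqP; split => // w /= wx.
    by have := expR_gt0 (beta^-1 * w + ln c); rewrite ltNge (le_trans wx).
  (* The branch law is given for positive arguments only. For [x <= 0], monotonicity bounds the mass
     of the ray by [sc_log_cdf n (ln e) <= e] for every [e > 0], so it is 0. *)
  apply/eqP; rewrite eq_le measure_ge0 andbT; apply/lee_addgt0Pr => e e0.
  rewrite add0e.
  apply: (@le_trans _ _ (sc_log_cdf n (ln e))%:E).
    rewrite -cdf_selection_combining !fE//; apply: ge0_subset_integral => //.
    - by apply/measurable_EFinP; exact: measurable_funTS.
    - by move=> y _; rewrite lee_fin.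
    - move=> y /=; rewrite !in_itv/= => /le_trans; apply.
      by rewrite (le_trans x0)// expR_ge0.
  rewrite lee_fin -[leRHS]lnK ?posrE// ler_expR.
  have n1 : (1 : R) <= n%:R by rewrite ler1n.
  have := softplus_ge0 (ln e); have := softplus_ge (ln e); nra.
pose w := beta * (ln x - ln c).
have xE : x = expR (beta^-1 * w + ln c).
  by rewrite /w mulKf ?gt_eqF// subrK lnK.
rewrite [in LHS]xE cdf_selection_combining.
rewrite (_ : [set w | (expR _ <= x)%R] = `]-oo, w]%classic); last first.
  apply/seteqP; split => z /=;
    rewrite in_itv/= xE ler_expR lerD2r ler_pM2l ?invr_gt0//.
rewrite (ge0_integral_FTCNy _ (@continuous_sc_log_pdf n) (sc_log_pdf_ge0 n)
  (is_derive_sc_log_cdf n) (cvgNy_sc_log_cdf n0)).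
by rewrite subr0.
Qed.

Let v (w : R) : R := beta^-1 * w + ln c.
Let q := sc_log_pdf n.
(** The cutoff turns the capacity integral into one over the whole line, as the change of law
    requires; at the points [expR (v w)] it equals 1. *)
Let h (x : R) := ln (1 + x) * \1_(`[0, +oo[%classic : set R) x.

Let mf : measurable_fun setT f. Proof. by have [] := fpdf. Qed.
Let f0 x : 0 <= f x. Proof. by have [] := fpdf. Qed.
Let mq : measurable_fun setT q.
Proof. by apply: continuous_measurable_fun; exact: continuous_sc_log_pdf. Qed.
Let cv : continuous v.
Proof. by move=> w; apply: cvgD;
  [apply: cvgM; [exact: cvg_cst|exact: cvg_id]|exact: cvg_cst]. Qed.
Let mv : measurable_fun setT v.
Proof. exact: continuous_measurable_fun. Qed.
Let mphi : measurable_fun setT (fun w => expR (v w)).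
Proof. exact: measurableT_comp. Qed.
Let fin (x : R) : (\int[mu]_(y in `]-oo, x]) (f y)%:E < +oo)%E.
Proof.
have [_ _ fE] := fpdf; apply: (@le_lt_trans _ _ (\int[mu]_y (f y)%:E)%E).
  apply: ge0_subset_integral => //; first exact/measurable_EFinP.
  by move=> y _; rewrite lee_fin.
by rewrite -fE// preimage_setT probability_setT ltry.
Qed.
Let mh : measurable_fun setT h.
Proof.
apply: measurable_funM => //; apply: measurableT_comp => //.
exact: measurable_funD.
Qed.

Let hphi w : h (expR (v w)) = softplus (v w).
Proof. by rewrite /h indicE mem_setE in_itv/= expR_ge0 mulr1. Qed.

Lemma integrable_capacity : L1 (fun w => softplus (v w) * q w) ->
  mu.-integrable `[0, +oo[ (EFin \o capacity_integrand f).
Proof.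
move=> H; apply/integrable_mkcond => //.
have : L1 (fun x => h x * f x).
  apply/(integrable_law mf f0 mq (@sc_log_pdf_ge0 n) mphi fin
    integral_pdf_selection_combining mh).
  by under eq_fun do rewrite hphi.
apply: eq_integrable => // x _; rewrite /= patchE /h indicE.
by case: ifPn => _; rewrite ?mulr1// mulr0 mul0r.
Qed.

Lemma Rintegral_capacity : L1 (fun w => softplus (v w) * q w) ->
  \int[mu]_(x in
    `[0, +oo[) capacity_integrand f x = \int[mu]_w (softplus (v w) * q w).
Proof.
move=> H; rewrite Rintegral_mkcond.
transitivity (\int[mu]_x (h x * f x)).
  apply: eq_Rintegral => x _; rewrite /= patchE /h indicE.
  by case: ifPn => _; rewrite ?mulr1// mulr0 mul0r.
rewrite (Rintegral_law mf f0 mq (@sc_log_pdf_ge0 n) mphi fin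
  integral_pdf_selection_combining mh).
- by apply: eq_Rintegral => w _; rewrite hphi.
- apply/(integrable_law mf f0 mq (@sc_log_pdf_ge0 n) mphi fin
    integral_pdf_selection_combining mh).
  by under eq_fun do rewrite hphi.
Qed.

End max.

(** * Moments of the maximum and the Mellin-Barnes double integral *)

Section MellinBarnes.
Variables (n : nat) (c beta tau : R).
Hypotheses (n0 : (0 < n)%N) (beta0 : 0 < beta).
Hypotheses (tau0 : tau < 0) (tau1 : -1 < tau) (taub : - beta < tau).
Let v (w : R) : R := beta^-1 * w + ln c.
Let q := sc_log_pdf n.
(** With [x = expR (v w)], the moment integrand [q w * x^(-t)] is [Q w] times a phase, so [Q] is its
    modulus on the line [Re t = tau]. *)
Let Q w := q w * expR (- tau * v w).

Let s1 : 0 < 1 + beta^-1 * tau.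
Proof. have : -1 < beta^-1 * tau by rewrite mulrC ltr_pdivlMr// mulN1r.
lra. Qed.

Let s2 : 0 < n%:R - beta^-1 * tau.
Proof.
have n1 : (1 : R) <= n%:R by rewrite ler1n.
have : beta^-1 * tau < 0 by rewrite pmulr_rlt0// invr_gt0.
lra.
Qed.

Let cv : continuous v.
Proof. by move=> w; apply: cvgD;
  [apply: cvgM; [exact: cvg_cst|exact: cvg_id]|exact: cvg_cst]. Qed.

Let cQ : continuous Q.
Proof.
move=> w; apply: cvgM; first exact: continuous_sc_log_pdf.
apply: (continuous_comp (f := fun w => - tau * v w));
  last exact: continuous_expR.
by apply: cvgM; [exact: cvg_cst|exact: cv].
Qed.

Let Q0 w : 0 <= Q w.
Proof. by rewrite mulr_ge0 ?sc_log_pdf_ge0 ?expR_ge0. Qed.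

(** The law of the maximum is a beta law with parameters 1 and [n]; the power [x^(-t)] shifts
    [t / beta] from one parameter to the other, so that their sum stays [n + 1]. *)
Let QE (w y : R) : (q w)%:C * cexp (- (tau +i* y) * (v w)%:C) =
  n%:R * cexp (- (tau +i* y) * (ln c)%:C) *
   beta_kernel (1 + beta^-1%:C * (tau +i* y)) (n%:R - beta^-1%:C * (tau +i* y))
     w.
Proof.
rewrite /q /sc_log_pdf rmorphM /= rmorph_nat -!mulrA; congr (_ * _).
rewrite -cexp_real -!cexpD; congr cexp.
rewrite -(rmorph_nat (real_complex R)) /v.
by apply: complex_ext => /=; ring.
Qed.

Lemma integrable_sc_moment : L1 Q.
Proof.
have m0 : 0 < Num.min (1 + beta^-1 * tau) (n%:R - beta^-1 * tau) by rewrite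
  lt_min s1 s2.
apply: integrable_dominated
  (integrableZ (n%:R * expR (- tau * ln c)) (integrable_expR_abs m0)) _.
  exact: continuous_measurable_fun.
move=> w; rewrite ger0_norm// /Q /q /sc_log_pdf -!mulrA ler_pM2l ?ltr0n//.
apply: (@le_trans _ _ (expR (- tau * ln c) * expR ((n%:R - beta^-1 * tau) * w -
  (1 + beta^-1 * tau + (n%:R - beta^-1 * tau)) * softplus w))); last first.
  by rewrite ler_pM2l ?expR_gt0//; exact: (expR_softplus_le w s1 s2).
by rewrite -!expRD ler_expR /v le_eqVlt; apply/orP; left; apply/eqP; ring.
Qed.

(** The logarithm is dominated by a positive power: [softplus (v w) * expR (tau * v w)] is bounded,
    so the moment of order [- tau] suffices. *)
Lemma integrable_softplus_sc : L1 (fun w => softplus (v w) * q w).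
Proof.
have [C [s s0 HC]] := @softplus_expR_le _ tau (introT andP (conj tau1 tau0)).
have C0 : 0 <= C.
  have h0 : 0 <= softplus 0 * expR (tau * 0) by rewrite mulr_ge0 ?softplus_ge0
    ?expR_ge0.
  by have := le_trans h0 (HC 0); rewrite normr0 mulr0 expR0 mulr1.
apply: integrable_dominated (integrableZ C integrable_sc_moment) _.
  apply: measurable_funM; apply: continuous_measurable_fun;
    last exact: continuous_sc_log_pdf.
  by move=> w; apply: (continuous_comp (f := v));
    [exact: cv|exact: continuous_softplus].
move=> w; rewrite ger0_norm ?mulr_ge0 ?softplus_ge0 ?sc_log_pdf_ge0//.
have -> : softplus (v w) * q w = (softplus (v w) * expR (tau * v w)) * Q w.
  rewrite /Q mulrACA [X in _ = _ * X]mulrC -mulrA; congr (_ * _).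
  by rewrite -[LHS]mulr1 -expR0; congr (_ * _); rewrite -expRD; congr expR;
    ring.
rewrite ler_wpM2r// (le_trans (HC _))// ler_piMr// expR_le1.
by rewrite mulNr oppr_le0 mulr_ge0// ltW.
Qed.

Lemma cGamma_sc_moment (y : R) :
  cGamma (n%:R - beta^-1%:C * (tau +i* y)) * cGamma
    (1 + beta^-1%:C * (tau +i* y)) *
    cexp (- (tau +i* y) * (ln c)%:C) =
  cGamma n%:R * cint (fun w => (Q w)%:C * cexp (0 +i* (- (y * v w)))).
Proof.
set t := tau +i* y.
have r1 : 0 < Re (1 + beta^-1%:C * t) by rewrite cReD cReM /=; move: s1; lra.
have r2 : 0 < Re (n%:R - beta^-1%:C * t).
  by rewrite cReD cReN cReM -(rmorph_nat (real_complex R)) /=; move: s2; lra.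
rewrite [X in X * _]mulrC cGammaM//.
have -> : 1 + beta^-1%:C * t + (n%:R - beta^-1%:C * t) = n%:R + 1 by ring.
have rn : 0 < Re (n%:R : R[i]) by rewrite -(rmorph_nat (real_complex R)) /=
  ltr0n.
(* [Gamma (n + 1) = n Gamma n] absorbs the factor [n] of the density and leaves the [Gamma n] of the
   final normalisation. *)
rewrite cGammaS//.
transitivity
  (cGamma n%:R *
  (n%:R * cexp (- t * (ln c)%:C) * cint
  (beta_kernel (1 + beta^-1%:C * t) (n%:R - beta^-1%:C * t)))).
  by ring.
congr (_ * _); rewrite -cintegralZ; last exact: cintegrable_beta_kernel.
apply: eq_cintegral => w; rewrite -QE /Q [in RHS]rmorphM /= -mulrA;
  congr (_ * _).
by rewrite -cexp_real -cexpD; congr cexp; apply: complex_ext => /=; ring.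
Qed.

Let K y := cint (log_kernel (tau +i* y)).
Let M y := cint (fun w => (Q w)%:C * cexp (0 +i* (- (y * v w)))).

Let Mi y : cL1 (fun w => (Q w)%:C * cexp (0 +i* (- (y * v w)))).
Proof.
apply: (cintegrable_dominated _ integrable_sc_moment).
  apply: cmeasurableM; first by apply: cmeasurable_real;
    exact: continuous_measurable_fun.
  apply: cmeasurable_exp; split; first exact: measurable_cst.
  apply: measurableT_comp => //; apply: measurable_funM => //.
  exact: continuous_measurable_fun.
by move=> w; rewrite Normc.normcM normc_cexp normc_real expR0 mulr1 ger0_norm.
Qed.

Let mM : cmeasurable
  (fun p : R * R => (Q p.2)%:C * cexp (0 +i* (- (p.1 * v p.2)))).
Proof.
apply: cmeasurableM.
  apply: cmeasurable_real; apply: measurableT_comp => //.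
  exact: continuous_measurable_fun.
apply: cmeasurable_exp; split; first exact: measurable_cst.
apply: measurableT_comp => //; apply: measurable_funM => //.
by apply: measurableT_comp => //; exact: continuous_measurable_fun.
Qed.

Let Ki : cL1 K.
Proof. by apply: cintegrable_log_kernel_line; rewrite tau1. Qed.

Let kk y := `|Re (K y)| + `|Im (K y)|.

Let kki : L1 kk.
Proof. by have [k1 k2] := Ki;
  exact: (integrableD _ (integrable_norm k1) (integrable_norm k2)). Qed.

(** The decay in [y] is taken from [K] alone; [M] is bounded by twice the integral of [Q]. *)
Lemma cintegrable_mellin_barnes : cL1 (fun y => K y * M y).
Proof.
apply: (@cintegrable_dominated _ _ (fun y => (2 * \int[mu]_w Q w) * kk y)).
- apply: cmeasurableM; first exact: cmeasurable_int.
  exact: (cmeasurable_cintegral mM).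
- by apply: integrableZ; exact: kki.
move=> y; rewrite Normc.normcM mulrC ler_pM ?normc_ge0//; last exact: normc_leD.
apply: normc_cintegral_le.
- by exact: cmeasurable_int.
- exact: integrable_sc_moment.
- by move=> w; rewrite Normc.normcM normc_cexp normc_real expR0 mulr1 ger0_norm.
Qed.

Lemma cintegral_mellin_barnes :
  cint (fun y => K y * M y) = (2 * pi * \int[mu]_w (softplus (v w) * q w))%:C.
Proof.
pose F (p : R * R) := K p.1 * ((Q p.2)%:C * cexp (0 +i* (- (p.1 * v p.2)))).
transitivity (cint (fun y => cint (fun w => F (y, w)))).
  by apply: eq_cintegral => y; rewrite /F /= cintegralZ.
rewrite (@cintegral_fubini _ F (fun y w => kk y * Q w)
  (fun y => (\int[mu]_w Q w) * kk y)).
- transitivity (cint (fun w => (2 * pi * (softplus (v w) * q w))%:C)).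
    apply: eq_cintegral => w.
    transitivity
      (cint (fun y => (Q w)%:C * (K y * cexp (0 +i* (- (y * v w)))))).
      by apply: eq_cintegral => y; rewrite /F /=; ring.
    rewrite cintegralZ; last first.
      apply: (cintegrable_dominated _ kki).
        apply: cmeasurableM; first exact: cmeasurable_int.
        apply: cmeasurable_exp; split; first exact: measurable_cst.
        by apply: measurableT_comp => //; exact: measurable_funM.
      by move=> y; rewrite Normc.normcM normc_cexp expR0 mulr1 normc_leD.
    (* Inversion produces [expR (tau * v w)], which cancels the weight [expR (- tau * v w)] inside
       [Q]: from here on the value is free of [tau]. *)
    rewrite log_kernel_inversion ?tau1// -rmorphM; congr (_ %:C).
    rewrite /Q mulrCA; congr (_ * _).
    rewrite mulrCA; congr (_ * _); rewrite -mulrA -[RHS]mulr1; congr (_ * _).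
    by rewrite -expRD -expR0; congr expR; ring.
  rewrite cintegral_real RintegralZl//; exact: integrable_softplus_sc.
- apply: cmeasurableM; last exact: mM.
  exact: (cmeasurable_comp (cmeasurable_int Ki)).
- move=> y w;
    have -> : F (y, w) = K y * ((Q w)%:C * cexp (0 +i* (- (y * v w)))) by [].
  rewrite (Normc.normcM (K y)) (Normc.normcM (Q w)%:C) normc_cexp normc_real
    expR0 mulr1 ger0_norm//.
  by rewrite ler_wpM2r// normc_leD.
- by move=> y; apply: integrableZ; exact: integrable_sc_moment.
- by move=> y; rewrite RintegralZl 1?mulrC//; exact: integrable_sc_moment.
- by apply: integrableZ; exact: kki.
Qed.

End MellinBarnes.

(** * Identification with the H-function *)

Section FoxH.
Variables (n : nat) (c beta : R).
Hypotheses (n0 : (0 < n)%N) (c0 : 0 < c) (beta0 : 0 < beta).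
Let a : seq (R[i] * R) := [:: (0, beta^-1); (0, 1); (1, 1)].
Let b : seq (R[i] * R) := [:: (n%:R, beta^-1); (0, 1); (0, 1)].

Lemma sc_separating (tau : R) :
  foxH_separating 3 2 a b tau <-> [/\ tau < 0, -1 < tau & - beta < tau].
Proof.
split=> [[H1 H2]|[t0 t1 tb]].
  (* The first poles decide: [t = 0] of [Gamma (- t)], [t = -1] of [Gamma (1 + t)] and [t = - beta]
     of [Gamma (1 + t / beta)]. Those of [Gamma (n - t / beta)], at [beta (n + k)], lie to the right
     of 0. *)
  split.
  - apply: (H1 (0, 1) _ 0%N 0); first by rewrite /= !inE eqxx !orbT.
    by apply: complex_ext => /=; ring.
  - apply: (H2 (0, 1) _ 0%N (-1)); first by rewrite /= !inE eqxx !orbT.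
    by apply: complex_ext => /=; ring.
  - apply: (H2 (0, beta^-1) _ 0%N (- beta)%:C); first by rewrite /= !inE eqxx.
    by apply: complex_ext => /=; field; rewrite gt_eqF.
have kE (k : nat) : Re (- k%:R : R[i]) = - k%:R.
  by rewrite -(rmorph_nat (real_complex R)).
split=> u + k t H.
- have := congr1 (@complex.Re R) H; rewrite kE => {}H.
  have k0 : (0 : R) <= k%:R by [].
  rewrite /= !inE => /or3P[] /eqP uE; move: H; rewrite {}uE.
  + rewrite cReD cReN cReM -(rmorph_nat (real_complex R)) /= mul0r subr0 => H.
    have -> : Re t = beta * (n%:R + k%:R).
      have : beta^-1 * Re t = n%:R + k%:R by lra.
      by move=> <-; rewrite mulVKf// gt_eqF.
    by rewrite (lt_le_trans t0)// mulr_ge0 ?addr_ge0// ltW.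
  + by rewrite cReD cReN cReM /=; lra.
  + by rewrite cReD cReN cReM /=; lra.
- have := congr1 (@complex.Re R) H; rewrite kE => {}H.
  have k0 : (0 : R) <= k%:R by [].
  rewrite /= !inE => /orP[] /eqP uE; move: H; rewrite {}uE.
  + rewrite !cReD cReN cReM /= mul0r subr0 => H.
    have -> : Re t = - beta * (1 + k%:R).
      have : beta^-1 * Re t = - (1 + k%:R) by lra.
      by rewrite mulNr -mulrN => <-; rewrite mulVKf// gt_eqF.
    by apply: le_lt_trans tb; rewrite mulNr lerN2 ler_pMr// lerDl.
  + by rewrite !cReD cReN cReM /=; lra.
Qed.

Lemma foxH_integrand_sc (tau y : R) : tau < 0 -> -1 < tau -> - beta < tau ->
  foxH_integrand 3 2 a b (1 / c) (tau +i* y) =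
  cGamma n%:R * (cint (log_kernel (tau +i* y)) *
    cint (fun w => (sc_log_pdf n w * expR (- tau * (beta^-1 * w + ln c)))%:C *
       cexp (0 +i* (- (y * (beta^-1 * w + ln c)))))).
Proof.
move=> t0 t1 tb; set t := tau +i* y.
rewrite /foxH_integrand /= !big_cons !big_nil /= !mulr1 !mul1r.
rewrite !sub0r !subr0.
have rt : Re (- t) = - tau by [].
have p1 : 0 < Re (- t) by rewrite rt oppr_gt0.
(* [b] lists [(0, 1)] twice, so [Gamma (- t)] occurs squared; one copy cancels against
   [Gamma (1 - t)] and leaves [- 1 / t]. *)
have g1 : cGamma (1 - t) = - t * cGamma (- t).
  by rewrite addrC cGammaS.
have gn0 : cGamma (- t) != 0 by exact: cGamma_neq0.
have tn0 : t != 0.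
  by apply: contraTneq t0 => /(congr1 (@complex.Re R)) /= ->; rewrite ltxx.
have zE : rcpow c^-1 t = cexp (- t * (ln c)%:C).
  rewrite /rcpow lnV ?posrE//; congr cexp.
  by apply: complex_ext => /=; ring.
have KE := @cGamma_log_kernel R t (introT andP (conj t1 t0)).
have ME := @cGamma_sc_moment n c beta tau n0 beta0 t0 tb y.
rewrite [RHS]mulrCA -ME -/t.
have -> : cint (log_kernel t) = - (cGamma (- t) * cGamma (1 + t)) / t.
  by rewrite KE; field.
rewrite g1 zE.
by field; rewrite gn0 tn0.
Qed.

Lemma is_foxH_sc :
  is_foxH 3 2 a b (1 / c)
    (cGamma n%:R *
      (\int[mu]_w (softplus (beta^-1 * w + ln c) * sc_log_pdf n w))%:C).
Proof.
split.
  (* The midpoint of the strip [- min(1, beta) < Re t < 0]. *)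
  exists (- (Num.min 1 beta / 2)); apply/sc_separating.
  have m1 : Num.min 1 beta <= 1 by rewrite ge_min lexx.
  have mb : Num.min 1 beta <= beta by rewrite ge_min lexx orbT.
  have m0 : 0 < Num.min 1 beta by rewrite lt_min ltr01.
  by split; lra.
move=> tau /sc_separating[t0 t1 tb].
have E y := @foxH_integrand_sc tau y t0 t1 tb.
have Mi := @cintegrable_mellin_barnes n c beta tau n0 beta0 t0 t1 tb.
split.
  by apply: eq_cintegrable (cintegrableZ (cGamma n%:R) Mi) => y; rewrite E.
rewrite /vline_integral (eq_cintegral E) cintegralZ// cintegral_mellin_barnes//.
rewrite [in LHS](rmorphM (real_complex R)) (rmorphM (real_complex R) 2)
  (rmorph_nat (real_complex R) 2).
have p0 : (pi%:C : R[i]) != 0 by rewrite fmorph_eq0 gt_eqF// pi_gt0.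
have i0 : 'i%C != 0 :> R[i] by rewrite eq_complex /= oner_eq0 andbF.
(* Stated for arbitrary complex numbers, so that [field] sees the integral and the Gamma value as
   atoms. *)
have cancel (I p G S : R[i]) : I != 0 -> p != 0 ->
    (2 * p * I)^-1 * (I * (G * (2 * p * S))) = G * S.
  by move=> I0 pi0; field; rewrite I0 pi0.
exact: cancel.
Qed.

End FoxH.

End SelectionCombining.

Theorem corollary2 (R : realType) (d : measure_display) (T : measurableType d)
    (P : probability T R) (L : nat) (rho alpha beta : R)
    (gamma : 'I_L -> {RV P >-> R}) (fSC : R -> R)
    (hL : (1 <= L)%N) (hrho : 0 < rho) (halpha : 0 < alpha) (hbeta : 0 < beta)
    (hindep : mutually_independent gamma)
    (hge0 : forall (i : 'I_L) (w : T), 0 <= gamma i w)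
    (hcdf : forall (i : 'I_L) (x : R), 0 < x ->
       cdf (gamma i) x = (1 / (1 + (x / (rho * alpha)) `^ (- beta)))%:E)
    (hpdf : is_pdf P (selection_combining (fun i w => gamma i w)) fSC) :
  lebesgue_measure.-integrable `[0, +oo[
    (fun x => (capacity_integrand fSC x)%:E) /\
  exists h : R[i],
    is_foxH 3 2
      [:: (0, beta^-1); (0, 1); (1, 1)]
      [:: (L%:R, beta^-1); (0, 1); (0, 1)]
      (1 / (alpha * rho)) h /\
    (ergodic_capacity fSC)%:C = ((ln 2)%:C * cGamma L%:R)^-1 * h.
Proof.
have c0 : 0 < rho * alpha by rewrite mulr_gt0.
(* Any abscissa of the strip would serve: it only sets the order [- tau] of the moment that
   dominates the logarithm. *)
pose tau : R := - (Num.min 1 beta / 2).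
have m1 : Num.min 1 beta <= 1 by rewrite ge_min lexx.
have mb : Num.min 1 beta <= beta by rewrite ge_min lexx orbT.
have m0 : 0 < Num.min 1 beta by rewrite lt_min ltr01.
have t0 : tau < 0 by rewrite /tau; lra.
have t1 : -1 < tau by rewrite /tau; lra.
have tb : - beta < tau by rewrite /tau; lra.
have Si := @integrable_softplus_sc R L (rho * alpha) beta tau hL hbeta t0 t1 tb.
split; first exact: (integrable_capacity hL c0 hbeta hindep hcdf hpdf Si).
exists (cGamma L%:R *
  (\int[lebesgue_measure]_w
  (softplus (beta^-1 * w + ln (rho * alpha)) * sc_log_pdf L w))%:C).
split; first by rewrite (mulrC alpha); exact: is_foxH_sc.
rewrite /ergodic_capacity (Rintegral_capacity hL c0 hbeta hindep hcdf hpdf Si).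
(* The prefactor [1 / Gamma L] is to be cancelled against the factor [Gamma L] of the H-function
   value. *)
have gn0 : cGamma (L%:R : R[i]) != 0.
  by apply: cGamma_neq0; rewrite -(rmorph_nat (real_complex R)) /= ltr0n.
rewrite invfM -mulrA mulKf// rmorphM fmorphV//.
Qed.
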